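(* There exists a nilpotent (polarised) Lie group $S$, not isomorphic to $F_{2,4}$, that is a modification of $F_{2,4}$ and is globally contactomorphic to $F_{2,4}$.
   Context: $F_{2,4}$ is the connected, simply connected Lie group whose Lie algebra is the free nilpotent real Lie algebra $\mathfrak g=\mathfrak f_{24}$ of rank $2$ and step $4$, with basis $e_1,\dots,e_8$ and nontrivial brackets $[e_2,e_1]=e_3$, $[e_3,e_1]=e_4$, $[e_3,e_2]=e_5$, $[e_4,e_1]=e_6$, $[e_5,e_1]=e_7$, $[e_4,e_2]=e_7$, $[e_5,e_2]=e_8$; it is stratified with $\mathfrak g_{-1}=\mathrm{span}\{e_1,e_2\}$, $\mathfrak g_{-2}=\mathrm{span}\{e_3\}$, $\mathfrak g_{-3}=\mathrm{span}\{e_4,e_5\}$, $\mathfrak g_{-4}=\mathrm{span}\{e_6,e_7,e_8\}$, and $F_{2,4}$ carries the left-invariant polarisation which at the identity is $\mathfrak g_{-1}$. A polarised Lie group is a pair $(S,\Delta_S)$ of a connected Lie group and a left-invariant bracket-generating subbundle $\Delta_S\subset TS$. Two polarised Lie groups $(S,\Delta_S)$, $(S',\Delta_{S'})$ are globally contactomorphic if there is a diffeomorphism $f:S\to S'$ with $f_*(\Delta_S)=\Delta_{S'}$. $\mathrm{Der}(\mathfrak g)$ is the Lie algebra of derivations $u$ of $\mathfrak g$ with $u(\mathfrak g_{-1})\subset\mathfrak g_{-1}$. For a Lie subalgebra $\mathfrak g_0\subset\mathrm{Der}(\mathfrak g)$, the Tanaka prolongation $\mathrm{Prol}(\mathfrak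 g,\mathfrak g_0)=\bigoplus_{k\ge -4}\mathfrak g_k$ is the maximal graded Lie algebra containing $\mathfrak g\oplus\mathfrak g_0$ as its non-positive part and such that $u\in\mathfrak g_k$, $k\ge 0$, $[u,\mathfrak g_{-1}]=0$ imply $u=0$; concretely, for $k\ge1$ inductively, $\mathfrak g_k$ is the space of linear maps $u:\mathfrak g\to\bigoplus_{j<k}\mathfrak g_j$ with $u(\mathfrak g_j)\subset\mathfrak g_{j+k}$ and $u([X,Y])=[u(X),Y]+[X,u(Y)]$ for $X,Y\in\mathfrak g$. Given a finite-dimensional Tanaka prolongation $\mathfrak p$, put $\mathfrak q=\bigoplus_{k\ge0}\mathfrak g_k$; a modification of $\mathfrak g$ in $\mathfrak p$ is a pair $(\mathfrak s,\mathfrak s_{-1})$ where $\mathfrak s\subset\mathfrak p$ is a Lie subalgebra with $\mathfrak p=\mathfrak s\oplus\mathfrak q$ (as vector spaces) and $\mathfrak s_{-1}=(\mathfrak g_{-1}\oplus\mathfrak q)\cap\mathfrak s$. A polarised Lie group $(S,\Delta_S)$ is a modification of $F_{2,4}$ if, for some finite-dimensional Tanaka prolongation $\mathfrak p$ of $\mathfrak g$ and some modification $(\mathfrak s,\mathfrak s_{-1})$ of $\mathfrak g$ in $\mathfrak p$, there is a Lie algebra isomorphism $\mathrm{Lie}(S)\to\mathfrak s$ mapping $(\Delta_S)_e$ onto $\mathfrak s_{-1}$. *)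

(* Defs.v *)
(* MathComp / MathComp-Analysis *)
From HB Require Import structures.
From mathcomp Require Import all_boot all_order all_algebra.
From mathcomp Require Import all_classical all_reals all_analysis.

Set Implicit Arguments.
Unset Strict Implicit.
Unset Printing Implicit Defensive.

Import Order.TTheory GRing.Theory Num.Theory.
Import numFieldNormedType.Exports.

Local Open Scope classical_set_scope.
Local Open Scope ring_scope.

(** * Smooth manifolds *)

(* U is always an open set below; on finite-dimensional spaces this is the
   usual class C^k, since x |-> 'd f x is C^k iff x |-> 'd f x v is C^k for
   every v. *)
Fixpoint Ck_on (R : realType) (V W : normedModType R) (k : nat) (U : set V)
    (f : V -> W) : Prop :=
  match k with
  | 0%N => forall x, U x -> {for x, continuous f}
  | k'.+1 => (forall x, U x -> differentiable f x) /\
             (forall v, Ck_on k' U (fun x => 'd f x v))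
  end.

Definition smooth_on (R : realType) (V W : normedModType R) (U : set V)
    (f : V -> W) : Prop :=
  forall k, Ck_on k U f.

(* A chart with values in E.  [chart_inv] matters only on
   [chart_map @` chart_dom]. *)
Record chart (R : realType) (E : normedModType R) (M : Type) := Chart {
  chart_dom : set M;
  chart_map : M -> E;
  chart_inv : E -> M }.

Record manifold (R : realType) (E : normedModType R) := Manifold {
  mcar :> topologicalType;
  atlas : set (chart E mcar) }.
Arguments atlas {R E} M : rename.

Definition is_chart (R : realType) (E : normedModType R) (M : topologicalType)
    (c : chart E M) : Prop :=
  [/\ open (chart_dom c),
      open (chart_map c @` chart_dom c),
      (forall x, chart_dom c x -> chart_inv c (chart_map c x) = x),
      (forall x, chart_dom c x -> {for x, continuous (chart_map c)}) &
      (forall y, (chart_map c @` chart_dom c) y ->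
         {for y, continuous (chart_inv c)})].

Definition is_manifold (R : realType) (E : normedModType R) (M : manifold E)
    : Prop :=
  [/\ hausdorff_space M,
      @second_countable M,
      (forall c, atlas M c -> is_chart c),
      (forall x : M, exists2 c, atlas M c & chart_dom c x) &
      (forall c c', atlas M c -> atlas M c' ->
         smooth_on (chart_map c @` (chart_dom c `&` chart_dom c'))
           (chart_map c' \o chart_inv c))].

Definition smooth_map (R : realType) (E E' : normedModType R)
    (M : manifold E) (N : manifold E') (f : M -> N) : Prop :=
  continuous f /\
  forall c c', atlas M c -> atlas N c' ->
    smooth_on (chart_map c @` (chart_dom c `&` f @^-1` chart_dom c'))
      (chart_map c' \o f \o chart_inv c).

Definition model_manifold (R : realType) (E : normedModType R) : manifold E :=
  @Manifold R E E [set @Chart R E E setT id id].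

Definition prod_chart (R : realType) (E E' : normedModType R) (M N : Type)
    (c : chart E M) (c' : chart E' N) : chart (E * E')%type (M * N)%type :=
  Chart (chart_dom c `*` chart_dom c')
    (fun p => (chart_map c p.1, chart_map c' p.2))
    (fun q => (chart_inv c q.1, chart_inv c' q.2)).

Definition prod_manifold (R : realType) (E E' : normedModType R)
    (M : manifold E) (N : manifold E') : manifold (E * E')%type :=
  @Manifold R (E * E')%type (M * N)%type
    [set d | exists c c', [/\ atlas M c, atlas N c' & d = prod_chart c c']].

Definition smooth_fun (R : realType) (E : normedModType R) (M : manifold E)
    (h : M -> R) : Prop :=
  smooth_map (N := model_manifold R) h.

Definition diffeomorphism (R : realType) (E E' : normedModType R)
    (M : manifold E) (N : manifold E') (f : M -> N) : Prop :=
  smooth_map f /\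
  exists g : N -> M, [/\ smooth_map g, cancel f g & cancel g f].

(** * Tangent vectors and vector fields *)

(* Tangent vectors are velocities of smooth curves, acting on smooth functions;
   a vector field is an operator on smooth functions.  To have a unique operator
   on all functions M -> R for each of them, they are made to vanish on the
   functions that are not smooth. *)
Definition velocity (R : realType) (E : normedModType R) (M : manifold E)
    (c : R -> M) : (M -> R) -> R :=
  fun h => if `[< smooth_fun h >] then derive1 (h \o c : R -> R) 0 else 0.

Definition tangent_space (R : realType) (E : normedModType R) (M : manifold E)
    (p : M) : set ((M -> R) -> R) :=
  [set v | exists c : R -> M,
     [/\ smooth_map (M := model_manifold R) c, c 0 = p & v = velocity c]].

(* The differential of f; only used for diffeomorphisms f, for which it
   preserves the convention above. *)
Definition push_vector (R : realType) (M N : Type) (f : M -> N)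
    (v : (M -> R) -> R) : (N -> R) -> R :=
  fun h => v (h \o f).

Definition vector_at (R : realType) (M : Type) (X : (M -> R) -> (M -> R))
    (p : M) : (M -> R) -> R :=
  fun h => X h p.

Definition vector_field (R : realType) (E : normedModType R) (M : manifold E)
    (X : (M -> R) -> (M -> R)) : Prop :=
  (forall p, tangent_space p (vector_at X p)) /\
  (forall h, smooth_fun h -> smooth_fun (M := M) (X h)).

Definition vf_bracket (R : realType) (M : Type)
    (X Y : (M -> R) -> (M -> R)) : (M -> R) -> (M -> R) :=
  fun h p => X (Y h) p - Y (X h) p.

(** * Lie algebras *)

Definition linear_subspace (R : realType) (V : lmodType R) (A : set V) : Prop :=
  A 0 /\ forall (a : R) x y, A x -> A y -> A (a *: x + y).

Definition lie_bracket (R : realType) (V : lmodType R) (br : V -> V -> V)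
    : Prop :=
  [/\ (forall (a : R) x y z, br (a *: x + y) z = a *: br x z + br y z),
      (forall (a : R) x y z, br z (a *: x + y) = a *: br z x + br z y),
      (forall x, br x x = 0) &
      (forall x y z, br x (br y z) + br y (br z x) + br z (br x y) = 0)].

(* phi restricts to an isomorphism from the Lie algebra (A, br) onto
   (A', br'). *)
Definition lie_algebra_iso (R : realType) (V V' : lmodType R)
    (A : set V) (br : V -> V -> V) (A' : set V') (br' : V' -> V' -> V')
    (phi : V -> V') : Prop :=
  [/\ (forall (a : R) x y, A x -> A y ->
         phi (a *: x + y) = a *: phi x + phi y),
      (forall x y, A x -> A y -> phi (br x y) = br' (phi x) (phi y)) &
      set_bij A A' phi].

(** * Polarised Lie groups *)

(* Raw data; the axioms are [is_polarised_lie_group]. *)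
Record polarised_group (R : realType) := PolarisedGroup {
  pg_dim : nat;
  pg_manifold :> manifold 'rV[R]_pg_dim;
  pg_mul : pg_manifold -> pg_manifold -> pg_manifold;
  pg_one : pg_manifold;
  pg_inv : pg_manifold -> pg_manifold;
  pg_polarisation : pg_manifold -> set ((pg_manifold -> R) -> R) }.

Definition is_lie_group (R : realType) (G : polarised_group R) : Prop :=
  [/\ is_manifold G,
      [/\ associative (@pg_mul R G),
          left_id (@pg_one R G) (@pg_mul R G) &
          left_inverse (@pg_one R G) (@pg_inv R G) (@pg_mul R G)],
      smooth_map (M := prod_manifold G G) (N := G)
        (fun p => pg_mul p.1 p.2) &
      smooth_map (@pg_inv R G)].

(* Lie(G), as the left-invariant vector fields with [vf_bracket]. *)
Definition lie_algebra (R : realType) (G : polarised_group R)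
    : set ((G -> R) -> (G -> R)) :=
  [set X | vector_field X /\
     forall (a : G) h, X (h \o pg_mul a) = X h \o pg_mul a].

(* The left-invariant sections of the polarisation, i.e. the subspace of Lie(G)
   corresponding to its fibre at the identity. *)
Definition horizontal (R : realType) (G : polarised_group R)
    : set ((G -> R) -> (G -> R)) :=
  [set X | lie_algebra X /\
     pg_polarisation (pg_one G) (vector_at X (pg_one G))].

Definition left_invariant_polarisation (R : realType) (G : polarised_group R)
    : Prop :=
  [/\ (forall p : G, pg_polarisation p `<=` tangent_space p),
      (forall p : G, linear_subspace (pg_polarisation p)) &
      (forall a p : G, pg_polarisation (pg_mul a p) =
         push_vector (pg_mul a) @` pg_polarisation p)].

Definition bracket_generating (R : realType) (G : polarised_group R) : Prop :=
  forall A : set ((G -> R) -> (G -> R)),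
    linear_subspace A -> (forall X Y, A X -> A Y -> A (vf_bracket X Y)) ->
    @horizontal R G `<=` A -> @lie_algebra R G `<=` A.

Definition is_polarised_lie_group (R : realType) (G : polarised_group R)
    : Prop :=
  [/\ is_lie_group G, connected [set: G],
      left_invariant_polarisation G & bracket_generating G].

Definition lie_group_isomorphic (R : realType) (G H : polarised_group R)
    : Prop :=
  exists2 f : G -> H, diffeomorphism f &
    forall x y, f (pg_mul x y) = pg_mul (f x) (f y).

Definition globally_contactomorphic (R : realType) (G H : polarised_group R)
    : Prop :=
  exists2 f : G -> H, diffeomorphism f &
    forall p, push_vector f @` pg_polarisation p = pg_polarisation (f p).

Definition simply_connected (R : realType) (T : topologicalType) : Prop :=
  connected [set: T] /\
  forall c : R -> T, {within `[0, 1], continuous c} -> c 0 = c 1 ->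
  exists H : R * R -> T,
    [/\ {within `[0, 1] `*` `[0, 1], continuous H},
        (forall t : R, t \in `[0, 1] -> H (t, 0) = c t),
        (forall t : R, t \in `[0, 1] -> H (t, 1) = c 0) &
        (forall s : R, s \in `[0, 1] -> H (0, s) = c 0 /\ H (1, s) = c 0)].

(** * Nilpotent groups *)

Definition is_subgroup (R : realType) (G : polarised_group R) (K : set G)
    : Prop :=
  [/\ K (pg_one G), (forall x y, K x -> K y -> K (pg_mul x y)) &
      (forall x, K x -> K (pg_inv x))].

Definition generated_subgroup (R : realType) (G : polarised_group R)
    (A : set G) : set G :=
  [set x | forall K : set G, is_subgroup K -> A `<=` K -> K x].

Definition commutator (R : realType) (G : polarised_group R) (x y : G) : G :=
  pg_mul (pg_mul (pg_inv x) (pg_inv y)) (pg_mul x y).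

Fixpoint lower_central (R : realType) (G : polarised_group R) (n : nat)
    : set G :=
  match n with
  | 0%N => setT
  | m.+1 => generated_subgroup
      [set z | exists x y, lower_central m x /\ z = commutator x y]
  end.

Definition nilpotent_group (R : realType) (G : polarised_group R) : Prop :=
  exists n, @lower_central R G n = [set pg_one G].

(** * The free nilpotent Lie algebra of rank 2 and step 4 *)

Notation f24 R := 'rV[R%type]_8.

(* The basis e_1, ..., e_8: the index n is 1-based. *)
Definition f24_basis (R : realType) (n : nat) : f24 R :=
  delta_mx 0 (inord n.-1).

Definition f24_coord (R : realType) (x : f24 R) (n : nat) : R :=
  x 0 (inord n.-1).

(* (i, j, k) stands for [e_i, e_j] = e_k. *)
Definition f24_table : seq (nat * nat * nat) :=
  [:: (2, 1, 3); (3, 1, 4); (3, 2, 5); (4, 1, 6); (5, 1, 7); (4, 2, 7);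
      (5, 2, 8)]%N.

Definition f24_bracket (R : realType) (x y : f24 R) : f24 R :=
  \sum_(t <- f24_table)
    (f24_coord x t.1.1 * f24_coord y t.1.2
     - f24_coord x t.1.2 * f24_coord y t.1.1) *: f24_basis R t.2.

Definition f24_stratum (R : realType) (j : int) : {vspace f24 R} :=
  let e := f24_basis R in
  if j == -1 then <<[:: e 1%N; e 2%N]>>%VS
  else if j == -2 then <<[:: e 3%N]>>%VS
  else if j == -3 then <<[:: e 4%N; e 5%N]>>%VS
  else if j == -4 then <<[:: e 6%N; e 7%N; e 8%N]>>%VS
  else 0%VS.

(** * The group F_{2,4} *)

(* The connected, simply connected group is f24 with the Baker-Campbell-Hausdorff
   product, whose terms of degree at least 5 vanish. *)
Definition f24_bch (R : realType) (x y : f24 R) : f24 R :=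
  let b := @f24_bracket R in
  x + y + 2^-1 *: b x y + 12^-1 *: (b x (b x y) + b y (b y x))
  - 24^-1 *: b y (b x (b x y)).

Definition F24_manifold (R : realType) : manifold (f24 R) :=
  model_manifold (f24 R).

Definition F24 (R : realType) : polarised_group R :=
  @PolarisedGroup R 8 (F24_manifold R) (@f24_bch R) 0 -%R
    (fun p => [set velocity (M := F24_manifold R) (fun t => f24_bch p (t *: v))
              | v in [set v | v \in f24_stratum R (-1)]]).

(* The property by which F_{2,4} is defined (up to isomorphism). *)
Definition F24_characterisation (R : realType) (F : polarised_group R) : Prop :=
  [/\ is_polarised_lie_group F, simply_connected R F &
      exists2 phi : ((F -> R) -> (F -> R)) -> f24 R,
        lie_algebra_iso (@lie_algebra R F) (@vf_bracket R F)
          setT (@f24_bracket R) phi &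
        phi @` @horizontal R F = [set x | x \in f24_stratum R (-1)]].

(** * Tanaka prolongations of f24 and modifications *)

(* g0 is a Lie subalgebra of Der(f24). *)
Definition der_subalgebra (R : realType) (g0 : {vspace 'End(f24 R)}) : Prop :=
  [/\ (forall u, u \in g0 -> forall x y,
         u (f24_bracket x y) = f24_bracket (u x) y + f24_bracket x (u y)),
      (forall u, u \in g0 -> forall x,
         x \in f24_stratum R (-1) -> u x \in f24_stratum R (-1)) &
      (forall u v, u \in g0 -> v \in g0 -> ((u \o v) - (v \o u))%VF \in g0)].

(* (P, br), with homogeneous components gr k and with f24 embedded in it by i,
   is the Tanaka prolongation Prol(f24, g0), with no component in degree > N.
   An element u of gr k, k >= 0, is determined by the map x |-> [u, x] on f24
   (transitivity); for k = 0 these maps are exactly those in g0, and for k > 0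
   they are all the maps of degree k satisfying the derivation rule. *)
Definition tanaka_prolongation (R : realType) (g0 : {vspace 'End(f24 R)})
    (P : vectType R) (br : P -> P -> P) (gr : int -> {vspace P}) (N : nat)
    (i : 'Hom(f24 R, P)) : Prop :=
  [/\ lie_bracket br,
      [/\ (forall (j k : int) u v, u \in gr j -> v \in gr k -> br u v \in gr (j + k)),
          (forall k : int, N%:Z < k -> gr k = 0%VS),
          directv (\sum_(k < N + 5) gr (k%:Z - 4%:Z))%VS &
          (\sum_(k < N + 5) gr (k%:Z - 4%:Z))%VS = fullv],
      [/\ lker i = 0%VS,
          (forall x y, i (f24_bracket x y) = br (i x) (i y)) &
          (forall k : int, k < 0 -> gr k = (i @: f24_stratum R k)%VS)],
      (forall D : 'End(f24 R), D \in g0 <->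
         exists2 u, u \in gr 0 & forall x, br u (i x) = i (D x)) &
      (forall (k : int) u, 0 <= k -> u \in gr k ->
         (forall x, x \in f24_stratum R (-1) -> br u (i x) = 0) -> u = 0) /\
      (forall (k : int) (D : 'Hom(f24 R, P)), 0 < k ->
         (forall (j : int) x, x \in f24_stratum R j -> D x \in gr (j + k)) ->
         (forall x y,
            D (f24_bracket x y) = br (D x) (i y) + br (i x) (D y)) ->
         exists2 u, u \in gr k & forall x, br u (i x) = D x)].

Definition nonneg_part (R : realType) (P : vectType R)
    (gr : int -> {vspace P}) (N : nat) : {vspace P} :=
  (\sum_(k < N.+1) gr k%:Z)%VS.

Definition algebra_modification (R : realType) (P : vectType R)
    (br : P -> P -> P) (gr : int -> {vspace P}) (N : nat)
    (s sm1 : {vspace P}) : Prop :=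
  let q := nonneg_part gr N in
  [/\ (forall u v, u \in s -> v \in s -> br u v \in s),
      (s + q)%VS = fullv, (s :&: q)%VS = 0%VS &
      sm1 = ((gr (-1) + q) :&: s)%VS].

Definition modification_of_F24 (R : realType) (S : polarised_group R) : Prop :=
  exists g0 (P : vectType R) (br : P -> P -> P) (gr : int -> {vspace P})
    (N : nat) (i : 'Hom(f24 R, P)) (s sm1 : {vspace P}),
  [/\ der_subalgebra g0,
      tanaka_prolongation g0 br gr N i,
      algebra_modification br gr N s sm1 &
      exists2 phi : ((S -> R) -> (S -> R)) -> P,
        lie_algebra_iso (@lie_algebra R S) (@vf_bracket R S)
          [set u | u \in s] br phi &
        phi @` @horizontal R S = [set u | u \in sm1]].

(* Main.v *)
Require Import Defs.
From HB Require Import structures.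
From mathcomp Require Import all_boot all_order all_algebra.
From mathcomp Require Import all_classical all_reals all_analysis.
From mathcomp Require Import ring lra.

(* Let D be the derivation of f24 with D e1 = e2 and D e2 = 0, and let
   A t = exp (t D), a one-parameter group of graded automorphisms of F24.  The
   pairs (p, A (s * p_1)), where p_1 is the first coordinate of p, form a subgroup
   of the semidirect product of F24 by the A t, because A t and the translations
   combine additively on first coordinates.  In the coordinate p it is R^8 with
   the product p * A (s * p_1) q.  Its left translations are compositions of left
   translations of F24 with automorphisms preserving the first stratum, so the
   polarisation of F24 is invariant under them: the identity map is a
   contactomorphism.  For s = 0 the group is F24; for s = 1 it is still nilpotent,
   since D is nilpotent, but [e4, e1] becomes e6 - e5 and then
   [e6 - e5, e1] = -3 e7, so its step is larger than 4.

   Its Lie algebra is the graph of v |-> v_1 D in f24 + <D>.  The latter is the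
   Tanaka prolongation of (f24, <D>): an element u of degree 1, with u e1 = a D
   and u e2 = b D, must satisfy 0 = u [e6, e1] = b e6 - 3 a e7. *)

Set Implicit Arguments.
Unset Strict Implicit.
Unset Printing Implicit Defensive.

Import Order.TTheory GRing.Theory Num.Theory.
Import numFieldNormedType.Exports.

Local Open Scope classical_set_scope.
Local Open Scope ring_scope.

Local Notation "x $ n" := (f24_coord x n)
  (at level 2, n at level 1, format "x $ n").

(** * Exponential coordinates *)

Section Algebra.
Variable R : realType.
Implicit Types (x y z u v w : f24 R) (s t a : R).

Lemma f24_ext x y : x$1 = y$1 -> x$2 = y$2 -> x$3 = y$3 -> x$4 = y$4 ->
  x$5 = y$5 -> x$6 = y$6 -> x$7 = y$7 -> x$8 = y$8 -> x = y.
Proof.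
move=> e1 e2 e3 e4 e5 e6 e7 e8; apply/rowP => -[i lti].
rewrite (_ : Ordinal lti = inord i); last by apply: val_inj; rewrite /= inordK.
by case: i lti => [|[|[|[|[|[|[|[|]]]]]]]].
Qed.

Lemma coordD x y n : (x + y)$n = x$n + y$n.
Proof. by rewrite /f24_coord !mxE. Qed.

Lemma coordN x n : (- x)$n = - x$n.
Proof. by rewrite /f24_coord !mxE. Qed.

Lemma coordZ a x n : (a *: x)$n = a * x$n.
Proof. by rewrite /f24_coord !mxE. Qed.

Lemma coord0 n : (0 : f24 R)$n = 0.
Proof. by rewrite /f24_coord !mxE. Qed.

(** Vectors are put in this explicit form so that a polynomial identity in [f24] splits into eight
    scalar identities, which [ring] or [field] decide. *)
Definition row8 (a1 a2 a3 a4 a5 a6 a7 a8 : R) : f24 R :=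
  \row_(i < 8) [:: a1; a2; a3; a4; a5; a6; a7; a8]`_i.

Lemma coord_row8 (a1 a2 a3 a4 a5 a6 a7 a8 : R)
    (x := row8 a1 a2 a3 a4 a5 a6 a7 a8) :
  ((x$1 = a1) * (x$2 = a2) * (x$3 = a3) * (x$4 = a4) *
   (x$5 = a5) * (x$6 = a6) * (x$7 = a7) * (x$8 = a8))%type.
Proof. by rewrite /x /f24_coord !mxE !inordK. Qed.

Lemma coord_basis m n : (0 < m <= 8)%N -> (0 < n <= 8)%N ->
  (f24_basis R m)$n = (m == n)%:R.
Proof.
case: m n => [|m] [|n] //= m8 n8; rewrite /f24_coord /f24_basis mxE eqxx /=.
by rewrite -val_eqE /= !inordK// eqSS eq_sym.
Qed.

Lemma coord_bracket x y (z := f24_bracket x y) :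
  ((z$1 = 0%R) * (z$2 = 0%R) * (z$3 = (x$2 * y$1 - x$1 * y$2)%R) *
   (z$4 = (x$3 * y$1 - x$1 * y$3)%R) * (z$5 = (x$3 * y$2 - x$2 * y$3)%R) *
   (z$6 = (x$4 * y$1 - x$1 * y$4)%R) *
   (z$7 = (x$5 * y$1 - x$1 * y$5 + (x$4 * y$2 - x$2 * y$4))%R) *
   (z$8 = (x$5 * y$2 - x$2 * y$5)%R))%type.
Proof.
rewrite /z /f24_bracket /f24_table !big_cons big_nil /=.
do !split; rewrite !(coordD, coordZ, coord0) !coord_basis//=; ring.
Qed.

Lemma row8_eta x : x = row8 x$1 x$2 x$3 x$4 x$5 x$6 x$7 x$8.
Proof. by apply: f24_ext; rewrite coord_row8. Qed.

Lemma add_row8 (x1 x2 x3 x4 x5 x6 x7 x8 y1 y2 y3 y4 y5 y6 y7 y8 : R) :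
  row8 x1 x2 x3 x4 x5 x6 x7 x8 + row8 y1 y2 y3 y4 y5 y6 y7 y8 =
  row8 (x1 + y1) (x2 + y2) (x3 + y3) (x4 + y4) (x5 + y5) (x6 + y6) (x7 + y7)
    (x8 + y8).
Proof. by apply: f24_ext; rewrite coordD !coord_row8. Qed.

Lemma scale_row8 a (x1 x2 x3 x4 x5 x6 x7 x8 : R) :
  a *: row8 x1 x2 x3 x4 x5 x6 x7 x8 =
  row8 (a * x1) (a * x2) (a * x3) (a * x4) (a * x5) (a * x6) (a * x7) (a * x8).
Proof. by apply: f24_ext; rewrite coordZ !coord_row8. Qed.

Lemma opp_row8 (x1 x2 x3 x4 x5 x6 x7 x8 : R) :
  - row8 x1 x2 x3 x4 x5 x6 x7 x8 =
  row8 (- x1) (- x2) (- x3) (- x4) (- x5) (- x6) (- x7) (- x8).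
Proof. by apply: f24_ext; rewrite coordN !coord_row8. Qed.

Lemma row8_0 : 0 = row8 0 0 0 0 0 0 0 0.
Proof. by apply: f24_ext; rewrite coord0 !coord_row8. Qed.

Lemma bracket_row8 (x1 x2 x3 x4 x5 x6 x7 x8 y1 y2 y3 y4 y5 y6 y7 y8 : R) :
  f24_bracket (row8 x1 x2 x3 x4 x5 x6 x7 x8) (row8 y1 y2 y3 y4 y5 y6 y7 y8) =
  row8 0 0 (x2 * y1 - x1 * y2) (x3 * y1 - x1 * y3) (x3 * y2 - x2 * y3)
    (x4 * y1 - x1 * y4) (x5 * y1 - x1 * y5 + (x4 * y2 - x2 * y4))
    (x5 * y2 - x2 * y5).
Proof. by apply: f24_ext; rewrite coord_bracket !coord_row8. Qed.

(** [b3] to [b8] are the coordinates of [x, y]. The terms of degree three combine to 12^-1 [x - y,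
    [x, y]], whence the factors [y1 - x1] and [y2 - x2]. *)
Lemma bch_row8 (x1 x2 x3 x4 x5 x6 x7 x8 y1 y2 y3 y4 y5 y6 y7 y8 : R)
    (b3 := x2 * y1 - x1 * y2) (b4 := x3 * y1 - x1 * y3)
    (b5 := x3 * y2 - x2 * y3) (b6 := x4 * y1 - x1 * y4)
    (b7 := x5 * y1 - x1 * y5 + (x4 * y2 - x2 * y4))
    (b8 := x5 * y2 - x2 * y5) :
  f24_bch (row8 x1 x2 x3 x4 x5 x6 x7 x8) (row8 y1 y2 y3 y4 y5 y6 y7 y8) =
  row8 (x1 + y1) (x2 + y2) (x3 + y3 + 2^-1 * b3)
    (x4 + y4 + 2^-1 * b4 + 12^-1 * (y1 - x1) * b3)
    (x5 + y5 + 2^-1 * b5 + 12^-1 * (y2 - x2) * b3)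
    (x6 + y6 + 2^-1 * b6 + 12^-1 * (y1 - x1) * b4 - 24^-1 * x1 * y1 * b3)
    (x7 + y7 + 2^-1 * b7 + 12^-1 * ((y1 - x1) * b5 + (y2 - x2) * b4)
       - 24^-1 * (x1 * y2 + x2 * y1) * b3)
    (x8 + y8 + 2^-1 * b8 + 12^-1 * (y2 - x2) * b5 - 24^-1 * x2 * y2 * b3).
Proof.
rewrite /f24_bch /=; do 6 rewrite ?bracket_row8 ?add_row8 ?scale_row8 ?opp_row8.
rewrite /b3 /b4 /b5 /b6 /b7 /b8.
congr row8; ring.
Qed.

(* exp (t D), where D is [derivation] below. *)
Definition shear t x : f24 R :=
  row8 x$1 (x$2 + t * x$1) x$3 x$4 (x$5 + t * x$4) x$6 (x$7 + 2 * t * x$6)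
    (x$8 + t * x$7 + t ^+ 2 * x$6).

Definition gmul s x y : f24 R := f24_bch x (shear (s * x$1) y).
(** The inverse of the pair (p, A t), with t = s p_1, is (A (- t) (- p), A (- t)). *)
Definition ginv s x : f24 R := shear (- (s * x$1)) (- x).

Lemma shear_row8 t (x1 x2 x3 x4 x5 x6 x7 x8 : R) :
  shear t (row8 x1 x2 x3 x4 x5 x6 x7 x8) =
  row8 x1 (x2 + t * x1) x3 x4 (x5 + t * x4) x6 (x7 + 2 * t * x6)
    (x8 + t * x7 + t ^+ 2 * x6).
Proof. by rewrite /shear !coord_row8. Qed.

Lemma gmul_row8 s (x1 x2 x3 x4 x5 x6 x7 x8 y1 y2 y3 y4 y5 y6 y7 y8 : R) :
  gmul s (row8 x1 x2 x3 x4 x5 x6 x7 x8) (row8 y1 y2 y3 y4 y5 y6 y7 y8) =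
  f24_bch (row8 x1 x2 x3 x4 x5 x6 x7 x8)
    (shear (s * x1) (row8 y1 y2 y3 y4 y5 y6 y7 y8)).
Proof. by rewrite /gmul !coord_row8. Qed.

Lemma ginv_row8 s (x1 x2 x3 x4 x5 x6 x7 x8 : R) :
  ginv s (row8 x1 x2 x3 x4 x5 x6 x7 x8) =
  shear (- (s * x1))
    (row8 (- x1) (- x2) (- x3) (- x4) (- x5) (- x6) (- x7) (- x8)).
Proof. by rewrite /ginv !coord_row8 opp_row8. Qed.

Definition row8E := (gmul_row8, ginv_row8, shear_row8, bch_row8, bracket_row8,
  add_row8, scale_row8, opp_row8).

(** The truncated series is associative because iterated brackets of degree five vanish; in
    coordinates this is a polynomial identity. *)
Lemma bchA : associative (@f24_bch R).
Proof.
move=> x y z; rewrite (row8_eta x) (row8_eta y) (row8_eta z) !bch_row8.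
by congr row8; field.
Qed.

(** The exponential of a derivation is an automorphism of the bracket, hence of the BCH product. *)
Lemma shear_bch t x y : shear t (f24_bch x y) = f24_bch (shear t x) (shear t y).
Proof.
rewrite (row8_eta x) (row8_eta y) !(shear_row8, bch_row8).
by congr row8; field.
Qed.

Lemma shearD s t x : shear (s + t) x = shear s (shear t x).
Proof. by rewrite (row8_eta x) !shear_row8; congr row8; ring. Qed.

Lemma shear0 x : shear 0 x = x.
Proof. by rewrite (row8_eta x) !shear_row8; congr row8; ring. Qed.

Lemma shear_coord1 t x : (shear t x)$1 = x$1.
Proof. by rewrite coord_row8. Qed.

Lemma bch_coord1 x y : (f24_bch x y)$1 = x$1 + y$1.
Proof. by rewrite {1}(row8_eta x) {1}(row8_eta y) bch_row8 coord_row8. Qed.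

Lemma bch0x : left_id 0 (@f24_bch R).
Proof.
by move=> x; rewrite (row8_eta x) row8_0 bch_row8; congr row8; ring.
Qed.

Lemma bchx0 : right_id 0 (@f24_bch R).
Proof.
by move=> x; rewrite (row8_eta x) row8_0 bch_row8; congr row8; ring.
Qed.

Lemma bchNx x : f24_bch (- x) x = 0.
Proof. by rewrite (row8_eta x) row8_0 opp_row8 bch_row8; congr row8; ring. Qed.

Lemma shear_x0 t : shear t 0 = 0.
Proof. by rewrite row8_0 shear_row8; congr row8; ring. Qed.

Lemma gmul_coord1 s x y : (gmul s x y)$1 = x$1 + y$1.
Proof. by rewrite bch_coord1 shear_coord1. Qed.

(** The first coordinate is additive under the product and fixed by shears, so the twists of [x] and
    [y] compose to the twist of their product. *)
Lemma gmulA s : associative (gmul s).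
Proof.
move=> x y z; rewrite {1 3}/gmul gmul_coord1 /gmul shear_bch bchA.
by rewrite -shearD -mulrDr.
Qed.

Lemma gmul0x s : left_id 0 (gmul s).
Proof. by move=> x; rewrite /gmul bch0x coord0 mulr0 shear0. Qed.

Lemma gmulx0 s : right_id 0 (gmul s).
Proof. by move=> x; rewrite /gmul shear_x0 bchx0. Qed.

Lemma gmulVx s : left_inverse 0 (ginv s) (gmul s).
Proof.
move=> x; rewrite /gmul /ginv shear_coord1 coordN mulrN.
by rewrite -shear_bch bchNx shear_x0.
Qed.

Lemma gmulxV s : right_inverse 0 (ginv s) (gmul s).
Proof.
move=> x; rewrite -[LHS](gmul0x s) -{1}(gmulVx s (ginv s x)) -gmulA.
by rewrite (gmulA s (ginv s x)) gmulVx gmul0x gmulVx.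
Qed.

Lemma gmulKx s x : cancel (gmul s x) (gmul s (ginv s x)).
Proof. by move=> y; rewrite gmulA gmulVx gmul0x. Qed.

Lemma gmulVKx s x : cancel (gmul s (ginv s x)) (gmul s x).
Proof. by move=> y; rewrite gmulA gmulxV gmul0x. Qed.

Lemma gmul_0 : gmul 0 = @f24_bch R.
Proof. by apply/funext => x; apply/funext => y; rewrite /gmul mul0r shear0. Qed.

Lemma ginv_0 : ginv 0 = -%R.
Proof. by apply/funext => x; rewrite /ginv mul0r oppr0 shear0. Qed.

(** * Commutators and the filtration by leading coordinates *)

Definition gcomm s x y := gmul s (gmul s (ginv s x) (ginv s y)) (gmul s x y).

(* Only meaningful for r <= 8: [f24_coord x k] is x$1 for k > 8. *)
Definition vanish r x := forall k, (0 < k <= r)%N -> x$k = 0.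

Lemma vanish8 x : vanish 8 x -> x = 0.
Proof. by move=> x0; apply: f24_ext; rewrite coord0 x0. Qed.

(** First of six inclusions [V_r, G] in V_r', with V_r the set cut out by [vanish r] and r running
    through 0, 2, 3, 4, 6, 7, 8. They hold for every [s] and give a central series. *)
Lemma gcomm_vanish2 s x y : vanish 2 (gcomm s x y).
Proof.
move=> k; rewrite /gcomm (row8_eta x) (row8_eta y) !row8E.
by case: k => [|[|[|k]]]// _; rewrite coord_row8; field.
Qed.

Lemma gcomm_vanish3 s x y : vanish 2 x -> vanish 3 (gcomm s x y).
Proof.
move=> x0 k; rewrite /gcomm (row8_eta x).
rewrite (x0 1)// (x0 2)// (row8_eta y) !row8E.
by case: k => [|[|[|[|k]]]]// _; rewrite coord_row8; field.
Qed.

Lemma gcomm_vanish4 s x y : vanish 3 x -> vanish 4 (gcomm s x y).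
Proof.
move=> x0 k; rewrite /gcomm (row8_eta x).
rewrite (x0 1)// (x0 2)// (x0 3)// (row8_eta y) !row8E.
by case: k => [|[|[|[|[|k]]]]]// _; rewrite coord_row8; field.
Qed.

Lemma gcomm_vanish6 s x y : vanish 4 x -> vanish 6 (gcomm s x y).
Proof.
move=> x0 k; rewrite /gcomm (row8_eta x).
rewrite (x0 1)// (x0 2)// (x0 3)// (x0 4)// (row8_eta y) !row8E.
by case: k => [|[|[|[|[|[|[|k]]]]]]]// _; rewrite coord_row8; field.
Qed.

Lemma gcomm_vanish7 s x y : vanish 6 x -> vanish 7 (gcomm s x y).
Proof.
move=> x0 k; rewrite /gcomm (row8_eta x).
rewrite (x0 1)// (x0 2)// (x0 3)// (x0 4)// (x0 5)// (x0 6)// (row8_eta y) !row8E.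
by case: k => [|[|[|[|[|[|[|[|k]]]]]]]]// _; rewrite coord_row8; field.
Qed.

Lemma gcomm_vanish8 s x y : vanish 7 x -> vanish 8 (gcomm s x y).
Proof.
move=> x0 k; rewrite /gcomm (row8_eta x).
rewrite (x0 1)// (x0 2)// (x0 3)// (x0 4)// (x0 5)// (x0 6)// (x0 7)// (row8_eta y) !row8E.
by case: k => [|[|[|[|[|[|[|[|[|k]]]]]]]]]// _; rewrite coord_row8; field.
Qed.

(** Without the twist [e4, e1] = e6 has no e5 component, so the filtration is the one by strata and
    reaches 0 sooner. *)
Lemma gcomm_vanish5_0 x y : vanish 3 x -> vanish 5 (gcomm 0 x y).
Proof.
move=> x0 k; rewrite /gcomm (row8_eta x).
rewrite (x0 1)// (x0 2)// (x0 3)// (row8_eta y) !row8E.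
by case: k => [|[|[|[|[|[|k]]]]]]// _; rewrite coord_row8; field.
Qed.

Lemma gcomm_vanish8_0 x y : vanish 5 x -> vanish 8 (gcomm 0 x y).
Proof.
move=> x0 k; rewrite /gcomm (row8_eta x).
rewrite (x0 1)// (x0 2)// (x0 3)// (x0 4)// (x0 5)// (row8_eta y) !row8E.
by case: k => [|[|[|[|[|[|[|[|[|k]]]]]]]]]// _; rewrite coord_row8; field.
Qed.

(** This group law, an expression of step four, is the invariant that tells [F24] from the twisted
    group. *)
Lemma gcomm4_0 x y1 y2 y3 y4 :
  gcomm 0 (gcomm 0 (gcomm 0 (gcomm 0 x y1) y2) y3) y4 = 0.
Proof.
by apply: vanish8; apply: gcomm_vanish8_0; apply: gcomm_vanish5_0;
   apply: gcomm_vanish3; apply: gcomm_vanish2.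
Qed.

(** The lowest terms follow the twisted Lie bracket with e1, which takes e2 to e3, e4, e6 - e5 and
    finally -3 e7; the last coefficient shows on coordinate 7. *)
Lemma gcomm4_1 (e1 := row8 1 0 0 0 0 0 0 0) (e2 := row8 0 1 0 0 0 0 0 0) :
  gcomm 1 (gcomm 1 (gcomm 1 (gcomm 1 e2 e1) e1) e1) e1 <> 0.
Proof.
have -> : gcomm 1 e2 e1 = row8 0 0 1 (1/2) 0 (1/6) (-(1/12)) (1/12).
  by rewrite /e1 ?/e2 /gcomm !row8E; congr row8; field.
have -> : gcomm 1 (row8 0 0 1 (1/2) 0 (1/6) (-(1/12)) (1/12)) e1 =
    row8 0 0 0 1 (-(3/2)) 1 (-(7/3)) (5/4).
  by rewrite /e1 ?/e2 /gcomm !row8E; congr row8; field.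
have -> : gcomm 1 (row8 0 0 0 1 (-(3/2)) 1 (-(7/3)) (5/4)) e1 =
    row8 0 0 0 0 (-1) 1 (-(11/2)) (35/6).
  by rewrite /e1 ?/e2 /gcomm !row8E; congr row8; field.
have -> : gcomm 1 (row8 0 0 0 0 (-1) 1 (-(11/2)) (35/6)) e1 =
    row8 0 0 0 0 0 0 (-3) (15/2).
  by rewrite /e1 ?/e2 /gcomm !row8E; congr row8; field.
move=> /(congr1 (fun x => x$7)); rewrite coord_row8 coord0; lra.
Qed.

(** Coordinate k of a product involves only coordinates of index at most k of the factors, in
    monomials without constant term. *)
Lemma gmul_vanish s r x y : (r <= 8)%N -> vanish r x -> vanish r y ->
  vanish r (gmul s x y).
Proof.
(* Trading [r] for k itself, which is at most 8, leaves a finite case analysis. *)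
move=> r8 x0 y0 k /andP[k0 kr]; have {r8} := leq_trans kr r8.
have {}x0 j : (0 < j <= k)%N -> x$j = 0.
  by case/andP=> j0 jk; rewrite x0// j0 (leq_trans jk).
have {}y0 j : (0 < j <= k)%N -> y$j = 0.
  by case/andP=> j0 jk; rewrite y0// j0 (leq_trans jk).
rewrite (row8_eta x) (row8_eta y) !row8E.
case: k k0 {kr} x0 y0 => [|[|[|[|[|[|[|[|[|k]]]]]]]]]// _ x0 y0 _.
all: rewrite ?coord_row8 ?(x0 1) ?(x0 2) ?(x0 3) ?(x0 4) ?(x0 5) ?(x0 6) ?(x0 7) ?(x0 8).
all: rewrite ?(y0 1) ?(y0 2) ?(y0 3) ?(y0 4) ?(y0 5) ?(y0 6) ?(y0 7) ?(y0 8)//.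
all: by field.
Qed.
End Algebra.

(** * Smooth functions *)

Section Ck.
Variable R : realType.

Lemma Ck_onW (V W : normedModType R) k (U : set V) (f : V -> W) :
  Ck_on k.+1 U f -> Ck_on k U f.
Proof.
elim: k f => [|k IH] f [df Cf].
  by move=> x Ux; exact/differentiable_continuous/df.
by split=> // v; exact/IH/Cf.
Qed.

Lemma Ck_cst (V W : normedModType R) k (U : set V) (a : W) :
  Ck_on k U (fun _ : V => a).
Proof.
elim: k a => [|k IH] a; first by move=> x _; exact: cvg_cst.
split=> [x _|v]; first exact: differentiable_cst.
rewrite (_ : (fun x => _) = fun=> 0) //.
by apply/funext => x; rewrite diff_cst.
Qed.

Lemma Ck_linear (V W : normedModType R) k (U : set V) (f : {linear V -> W}) :
  continuous f -> Ck_on k U f.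
Proof.
move=> cf; case: k => [|k]; first by move=> x _; exact: cf.
split=> [x _|v]; first exact: linear_differentiable.
rewrite (_ : (fun x => _) = fun=> f v); first exact: Ck_cst.
by apply/funext => x; rewrite diff_lin.
Qed.

Lemma Ck_add (V W : normedModType R) k (f g : V -> W) :
  Ck_on k setT f -> Ck_on k setT g -> Ck_on k setT (fun x => f x + g x).
Proof.
elim: k f g => [|k IH] f g.
  by move=> cf cg x Ux; apply: cvgD; [exact: cf|exact: cg].
move=> [df Cf] [dg Cg]; split=> [x Ux|v].
  by apply: differentiableD; [exact: df|exact: dg].
rewrite (_ : (fun x => _) = fun x => 'd f x v + 'd g x v).
  exact: IH (Cf v) (Cg v).
by apply/funext => x; rewrite diffD//; [exact: df|exact: dg].
Qed.

Lemma Ck_scalel (V W : normedModType R) k (f : V -> R) (w : W) :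
  Ck_on k setT f -> Ck_on k setT (fun x => f x *: w).
Proof.
elim: k f => [|k IH] f.
  by move=> cf x Ux; apply: cvgZr_tmp; exact: cf.
move=> [df Cf]; split=> [x Ux|v].
  by apply: differentiableZl; exact: df.
rewrite (_ : (fun x => _) = fun x => 'd f x v *: w).
  exact: IH (Cf v).
by apply/funext => x; rewrite diffZl//; exact: df.
Qed.

(** The Leibniz rule yields products of functions that are C^k, two of them by [Ck_onW], so the
    induction closes. *)
Lemma Ck_mul (V : normedModType R) k (f g : V -> R) :
  Ck_on k setT f -> Ck_on k setT g -> Ck_on k setT (fun x => f x * g x).
Proof.
elim: k f g => [|k IH] f g.
  by move=> cf cg x Ux; apply: cvgM; [exact: cf|exact: cg].
move=> Ckf Ckg; have [df Cf] := Ckf; have [dg Cg] := Ckg; split=> [x Ux|v].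
  by apply: differentiableM; [exact: df|exact: dg].
rewrite (_ : (fun x => _) = fun x => f x * 'd g x v + g x * 'd f x v).
  by apply: Ck_add; apply: IH;
    [exact: Ck_onW|exact: Cg|exact: Ck_onW|exact: Cf].
by apply/funext => x; rewrite diffM//; [exact: df|exact: dg].
Qed.

Lemma Ck_sum (V W : normedModType R) k (I : Type) (r : seq I) (F : I -> V -> W) :
  (forall i, Ck_on k setT (F i)) -> Ck_on k setT (fun x => \sum_(i <- r) F i x).
Proof.
move=> CF; elim: r => [|i r IH].
  by under eq_fun do rewrite big_nil; exact: Ck_cst.
by under eq_fun do rewrite big_cons; exact: Ck_add.
Qed.

Lemma Ck_coordinate (V : normedModType R) n k (f : V -> 'rV[R]_n) i :
  Ck_on k setT f -> Ck_on k setT (fun x => f x 0 i : R).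
Proof.
elim: k f => [|k IH] f.
  move=> cf x Ux; apply: (@continuous_comp _ _ _ f (fun M : 'rV[R]_n => M 0 i)).
    exact: cf.
  exact: coord_continuous.
move=> [df Cf].
have dfi x : differentiable (fun x => f x 0 i : R) x.
  apply: (differentiable_comp (g := fun M : 'rV[R]_n => M 0 i)); first exact: df.
  exact: differentiable_coord.
split=> [x Ux|v]; first exact: dfi.
rewrite (_ : (fun x => _) = fun x => 'd f x v 0 i).
  exact: IH (Cf v).
apply/funext => x.
rewrite -!deriveE; [|exact: df|exact: dfi].
by rewrite derive_mx ?mxE//; apply/diff_derivable/df.
Qed.

Lemma Ck_row (V : normedModType R) n k (f : V -> 'rV[R]_n) :
  (forall i, Ck_on k setT (fun x => f x 0 i : R)) -> Ck_on k setT f.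
Proof.
move=> Cf; rewrite (_ : f = fun x => \sum_i f x 0 i *: delta_mx 0 i).
  by apply: Ck_sum => i; exact: Ck_scalel.
by apply/funext => x; exact: row_sum_delta.
Qed.

(** [Ck_on] differentiates in fixed directions, while in the chain rule the direction ['d f x v]
    varies with x. Expanding it in the standard basis of the intermediate space restores fixed
    directions. *)
Lemma Ck_comp (V : normedModType R) n k (f : V -> 'rV[R]_n)
    (g : 'rV[R]_n -> R) :
  Ck_on k setT f -> Ck_on k setT g -> Ck_on k setT (g \o f).
Proof.
elim: k f g => [|k IH] f g.
  by move=> cf cg x _; apply: continuous_comp; [exact: cf|exact: cg].
move=> Cf Cg; have [df Cdf] := Cf; have [dg Cdg] := Cg; split=> [x _|v].
  by apply: differentiable_comp; [exact: df|exact: dg].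
rewrite (_ : (fun x => _) = fun x =>
    \sum_i 'd f x v 0 i * ((fun y => 'd g y (delta_mx 0 i)) \o f) x).
  apply: Ck_sum => i; apply: Ck_mul; first exact/Ck_coordinate/Cdf.
  exact: (IH f (fun y => 'd g y (delta_mx 0 i)) (Ck_onW Cf) (Cdg _)).
apply/funext => x; rewrite diff_comp; [|exact: df|exact: dg].
rewrite /= {1}(row_sum_delta ('d f x v)) raddf_sum /=; apply: eq_bigr => i _.
by rewrite linearZ.
Qed.

End Ck.

(** * Symmetry of second derivatives *)

Section Schwarz.
Variables (R : realType) (V : normedModType R).
Implicit Types (h : V -> R) (p v w : V).

Lemma is_derive_line h p v (s : R) : differentiable h (p + s *: v) ->
  is_derive s 1 (fun s : R => h (p + s *: v)) ('d h (p + s *: v) v).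
Proof.
move=> dh.
have dl : is_diff s (fun s : R => p + s *: v) (fun s : R => s *: v).
  have -> : (fun s : R => p + s *: v) = cst p + (fun s : R => s *: v) by [].
  by apply: is_diff_eq; rewrite add0r.
have dhl : is_diff s (h \o (fun s : R => p + s *: v))
    ('d h (p + s *: v) \o (fun s : R => s *: v)).
  by apply: is_diff_comp.
have dd : differentiable (h \o (fun s : R => p + s *: v)) s.
  exact: ex_diff.
split; first exact/diff_derivable.
by rewrite deriveE// diff_val /= scale1r.
Qed.

(* Two applications of the mean value theorem, first along v, then w. *)
Lemma second_difference h p v w (e : R) : 0 < e ->
  (forall x, differentiable h x) ->
  (forall x, differentiable (fun x => 'd h x v) x) ->
  exists s t, [/\ 0 < s < e, 0 < t < e &
    h (p + e *: w + e *: v) - h (p + e *: v) - (h (p + e *: w) - h p) =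
    e * e * 'd (fun x => 'd h x v) (p + s *: v + t *: w) w].
Proof.
move=> e0 dh ddh.
pose f (s : R) := h (p + e *: w + s *: v) - h (p + s *: v).
have df (s : R) : is_derive s (1 : R) f
    ('d h (p + e *: w + s *: v) v - 'd h (p + s *: v) v).
  by apply: is_deriveB; apply: is_derive_line.
have cf : {within `[0, e], continuous f}.
  apply: continuous_subspaceT => s.
  by apply/differentiable_continuous/derivable1_diffP; case: (df s).
have [s + fE] := MVT e0 (fun s _ => df s) cf.
rewrite in_itv /= => /andP[s0 se].
pose g (t : R) := 'd h (p + s *: v + t *: w) v.
have dg (t : R) : is_derive t (1 : R) g
    ('d (fun x => 'd h x v) (p + s *: v + t *: w) w).
  by apply: (is_derive_line (h := fun x => 'd h x v)).
have cg : {within `[0, e], continuous g}.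
  apply: continuous_subspaceT => t.
  by apply/differentiable_continuous/derivable1_diffP; case: (dg t).
have [t + gE] := MVT e0 (fun t _ => dg t) cg.
rewrite in_itv /= => /andP[t0 te].
exists s, t; rewrite s0 se t0 te; split => //.
move: fE gE; rewrite /f /g !scale0r !addr0 !subr0 => ->.
by rewrite (addrAC p) => ->; ring.
Qed.

(** The second difference is symmetric in [v] and [w], so each mixed derivative takes the same value
    at some point near [p]; by continuity both are then within e / 2 of that common value at [p]. *)
Lemma schwarz h p v w : Ck_on 2 setT h ->
  'd (fun x => 'd h x v) p w = 'd (fun x => 'd h x w) p v.
Proof.
move=> [dh0 Ch]; have dh x : differentiable h x by exact: dh0.
have dd u x : differentiable (fun x => 'd h x u) x by have [+ _] := Ch u; exact.
have cc u u' x : {for x, continuous (fun x => 'd (fun x => 'd h x u) x u')}.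
  by have [_ /(_ u')] := Ch u; exact.
apply/eqP; rewrite -subr_eq0 -normr_le0.
apply/ler_addgt0Pr => e e0; rewrite add0r.
have e20 : 0 < e / 2 by rewrite divr_gt0.
have /cvgrPdist_lt /(_ _ e20) /nbhs_ballP[d1 /= d10 B1] := cc v w p.
have /cvgrPdist_lt /(_ _ e20) /nbhs_ballP[d2 /= d20 B2] := cc w v p.
pose d := Num.min d1 d2.
have d0 : 0 < d by rewrite lt_min d10.
(* With steps shorter than [d / M] the displacement stays below [d]; the summand 1 keeps [M]
   positive when [v] and [w] vanish. *)
pose M := `|v| + `|w| + 1.
have M0 : 0 < M by rewrite ltr_wpDl// addr_ge0.
have a0 : 0 < d / M by rewrite divr_gt0.
have near_p s t : 0 < s < d / M -> 0 < t < d / M -> `|s *: v + t *: w| < d.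
  move=> /andP[s0 sd] /andP[t0 td].
  have : `|s *: v + t *: w| <= d / M * (`|v| + `|w|).
    rewrite (le_trans (ler_normD _ _))// !normrZ !gtr0_norm// mulrDr.
    by rewrite lerD// ler_wpM2r// ltW.
  move=> /le_lt_trans; apply; rewrite mulrAC ltr_pdivrMr// ltr_pM2l//.
  by rewrite /M ltrDl.
have [s [t [sd td E1]]] := @second_difference h p v w _ a0 dh (dd v).
have [t' [s' [td' sd' E2]]] := @second_difference h p w v _ a0 dh (dd w).
have : 'd (fun x => 'd h x v) (p + s *: v + t *: w) w =
       'd (fun x => 'd h x w) (p + t' *: w + s' *: v) v.
  apply: (mulfI (x := d / M * (d / M))); first by rewrite mulf_neq0 ?gt_eqF.
  rewrite -E1 -E2 (addrAC p); ring.
move: (near_p _ _ sd td) (near_p _ _ sd' td').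
set q := p + s *: v + _; set q' := p + t' *: w + _ => nq nq' E.
have /B1 /= h1 : ball p d1 q.
  rewrite -ball_normE /= /q -addrA opprD addrA subrr add0r normrN.
  by rewrite (lt_le_trans nq)// ge_min lexx.
have /B2 /= h2 : ball p d2 q'.
  rewrite -ball_normE /= /q' -addrA opprD addrA subrr add0r normrN addrC.
  by rewrite (lt_le_trans nq')// ge_min lexx orbT.
rewrite -E in h2; rewrite -[X in `|X - _|](subrK ('d (fun x => 'd h x v) q w)).
rewrite -addrA (le_trans (ler_normD _ _))//.
rewrite (splitr e) lerD//; first exact: ltW.
by rewrite distrC; exact: ltW.
Qed.

End Schwarz.

(** * The model manifolds *)

Section Topology.
Variable R : realType.

(** The base consists of the balls with rational centre and radius 1 / (N + 1). For 1 / (N + 1) < e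
    / 2, such a ball containing x lies in the ball of radius e around x. *)
Lemma rV_second_countable n : @second_countable 'rV[R]_n.
Proof.
pose f (q : 'rV[rat]_n * nat) : set 'rV[R]_n :=
  ball (map_mx ratr q.1 : 'rV[R]_n) (q.2.+1%:R^-1 : R).
exists (range f).
  by apply: (sub_countable (card_image_le _ _)); exact: countableP.
split; first by move=> _ [q _ <-]; exact: ball_open.
move=> x U /nbhs_ballP[e /= e0 eU].
have [N _ /(_ N (leqnn N)) /= hN] :=
  near_infty_natSinv_lt (PosNum (divr_gt0 e0 (@ltr0n R 2))).
have /= := hN; set d : R := N.+1%:R^-1 => de.
have d0 : 0 < d by rewrite invr_gt0.
have ratP (i : 'I_n) : exists q : rat, ratr q \in `](x 0 i - d), (x 0 i + d)[.
  by apply: rat_in_itvoo; rewrite ltrD2l gtrN.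
pose q : 'rV[rat]_n := \row_i sval (cid (ratP i)).
have qx : ball (map_mx ratr q : 'rV[R]_n) d x.
  split=> // i j; rewrite (ord1 i) !mxE; case: cid => a /=.
  rewrite in_itv /= /ball /= => /andP[h1 h2].
  by rewrite ltr_norml; apply/andP; split; lra.
exists (f (q, N)); first by split => //; exists (q, N).
apply: subset_trans eU => y qy.
rewrite -[e]/(PosNum e0)%:num [(PosNum e0)%:num]splitr /=.
apply: (@ball_triangle _ _ (map_mx ratr q : 'rV[R]_n)).
  by apply/ball_sym; apply: le_ball qx; exact: ltW.
by apply: le_ball qy; exact: ltW.
Qed.

(** The space is the union of the lines through 0, each a continuous image of the real line. *)
Lemma normed_connected (V : normedModType R) : connected [set: V].
Proof.
rewrite (_ : [set: V] = \bigcup_(x in [set: V]) range (fun t : R => t *: x)).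
  apply: bigcup_connected.
    by exists 0 => x _; exists 0 => //; rewrite scale0r.
  move=> x _; apply: connected_continuous_connected.
    by apply/connected_intervalP.
  apply: continuous_subspaceT => t.
  exact: scalel_continuous.
apply/seteqP; split => // x _.
by exists x => //; exists 1 => //; rewrite scale1r.
Qed.

(** Every loop contracts to its base point along straight segments. *)
Lemma normed_simply_connected (V : normedModType R) : simply_connected R V.
Proof.
split; first exact: normed_connected.
move=> c cc c01; exists (fun q : R * R => c 0 + (1 - q.2) *: (c q.1 - c 0)).
split=> [|t tI|t tI|s sI] /=; last 3 first.
- by rewrite subr0 scale1r addrC subrK.
- by rewrite subrr scale0r addr0.
- by rewrite -c01 subrr scaler0 addr0.
apply/subspace_continuousP => -[t s] [/= tI sI].
apply: cvgD; first exact: cvg_cst.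
apply: cvgZ.
  apply: cvg_within_filter.
  apply: cvgB; [exact: cvg_cst|exact: cvg_snd].
apply: cvgB; last exact: cvg_cst.
move/subspace_continuousP : cc => /(_ t tI) cc.
(* The loop is continuous only within [0, 1], so the first projection must be shown to converge
   within [0, 1] too. *)
suff h : (fun q : R * R => q.1) @ within (`[0, 1] `*` `[0, 1]) (nbhs (t, s)) -->
    within `[0, 1] (nbhs t) by exact: cvg_comp h cc.
move=> P /= /nbhs_ballP[e /= e0 eP].
exists (ball t e, setT) => /=.
  by split; [exact: nbhsx_ballx|exact: filterT].
by move=> [t' s'] /= [tt' _] [t'I _]; exact: eP.
Qed.
End Topology.

Section Model.
Variable R : realType.

Lemma model_smoothE (V W : normedModType R) (f : V -> W) :
  smooth_map (M := model_manifold V) (N := model_manifold W) f <->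
  forall k, Ck_on k setT f.
Proof.
have E : id @` (setT `&` f @^-1` setT) = [set: V].
  by apply/seteqP; split => // x _; exists x.
split=> [[_ /(_ _ _ erefl erefl) /=]|Cf].
  by rewrite /smooth_on E.
split=> [x|_ _ -> -> /=]; first exact: (Cf 0%N).
by rewrite /smooth_on E.
Qed.

(** The product chart is the identity only after destructing pairs; [E] and [E'] put its domain and
    the coordinate expression of [f] in plain form. *)
Lemma prod_model_smoothE (V V' W : normedModType R) (f : V * V' -> W) :
  smooth_map (M := prod_manifold (model_manifold V) (model_manifold V'))
    (N := model_manifold W) f <->
  forall k, Ck_on k setT f.
Proof.
have E : (fun p : V * V' => (p.1, p.2)) @`
    ((setT `*` setT) `&` f @^-1` setT) = [set: V * V'].
  by apply/seteqP; split => // -[x y] _; exists (x, y).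
have E' : (fun q : V * V' => f (q.1, q.2)) = f.
  by apply/funext => -[].
split=> [[_]|Cf].
  move=> /(_ (prod_chart (@Chart R V V setT id id) (@Chart R V' V' setT id id))
    (@Chart R W W setT id id) _ erefl) /= h.
  have : smooth_on [set: V * V'] f; last by [].
  rewrite -E -{2}E'; apply: h.
  by exists (@Chart R V V setT id id), (@Chart R V' V' setT id id).
split=> [x|_ _ [c [c' [-> -> ->]]] -> /=]; first exact: (Cf 0%N).
by rewrite /smooth_on /= E /comp /= E'.
Qed.

Lemma model_is_manifold n : is_manifold (model_manifold 'rV[R]_n).
Proof.
split.
- exact: norm_hausdorff.
- exact: rV_second_countable.
- move=> _ ->; split => //=.
  + exact: openT.
  + by rewrite image_id; exact: openT.
  + by move=> x _; exact: cvg_id.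
  + by move=> x _; exact: cvg_id.
- by move=> x; exists (@Chart R 'rV[R]_n 'rV[R]_n setT id id).
- move=> _ _ -> -> /=.
  have -> : id @` (setT `&` setT) = [set: 'rV[R]_n] by rewrite setIT image_id.
  move=> k; apply: (@Ck_linear R 'rV[R]_n 'rV[R]_n k setT idfun) => x.
  exact: cvg_id.
Qed.
End Model.

(** * Closure properties of smooth maps *)

Section Smooth.
Variable R : realType.

Definition Cinfty (V W : normedModType R) (f : V -> W) := forall k, Ck_on k setT f.

Lemma Cinfty_differentiable (V W : normedModType R) (f : V -> W) x :
  Cinfty f -> differentiable f x.
Proof. by move=> /(_ 1%N) [df _]; exact: df. Qed.

Lemma Cinfty_diff (V W : normedModType R) (f : V -> W) v :
  Cinfty f -> Cinfty (fun x => 'd f x v).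
Proof. by move=> Cf k; have [_] := Cf k.+1; exact. Qed.

Lemma Cinfty_id n : Cinfty (@id 'rV[R]_n).
Proof.
move=> k; apply: (@Ck_linear R 'rV[R]_n 'rV[R]_n k setT idfun) => x.
exact: cvg_id.
Qed.

Lemma Cinfty_add (V W : normedModType R) (f g : V -> W) :
  Cinfty f -> Cinfty g -> Cinfty (fun x => f x + g x).
Proof. by move=> Cf Cg k; exact: Ck_add. Qed.

Lemma Cinfty_mul (V : normedModType R) (f g : V -> R) :
  Cinfty f -> Cinfty g -> Cinfty (fun x => f x * g x).
Proof. by move=> Cf Cg k; exact: Ck_mul. Qed.

Lemma Cinfty_cst (V W : normedModType R) (a : W) : Cinfty (fun _ : V => a).
Proof. by move=> k; exact: Ck_cst. Qed.

Lemma Cinfty_opp (V : normedModType R) (f : V -> R) :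
  Cinfty f -> Cinfty (fun x => - f x).
Proof.
move=> Cf; rewrite (_ : (fun x => _) = fun x => -1 * f x).
  by apply: Cinfty_mul => //; exact: Cinfty_cst.
by apply/funext => x; rewrite mulN1r.
Qed.

Lemma Cinfty_coordinate (V : normedModType R) n (f : V -> 'rV[R]_n) i :
  Cinfty f -> Cinfty (fun x => f x 0 i : R).
Proof. by move=> Cf k; exact: Ck_coordinate. Qed.

Lemma Cinfty_row (V : normedModType R) n (f : V -> 'rV[R]_n) :
  (forall i, Cinfty (fun x => f x 0 i : R)) -> Cinfty f.
Proof. by move=> Cf k; apply: Ck_row => i; exact: Cf. Qed.

Lemma Cinfty_comp (V : normedModType R) n (f : V -> 'rV[R]_n)
    (g : 'rV[R]_n -> R) :
  Cinfty f -> Cinfty g -> Cinfty (g \o f).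
Proof. by move=> Cf Cg k; exact: Ck_comp. Qed.

Lemma Cinfty_sum (V W : normedModType R) (I : Type) (r : seq I) (F : I -> V -> W) :
  (forall i, Cinfty (F i)) -> Cinfty (fun x => \sum_(i <- r) F i x).
Proof. by move=> CF k; apply: Ck_sum => i; exact: CF. Qed.

Lemma Cinfty_scalel (V W : normedModType R) (f : V -> R) (w : W) :
  Cinfty f -> Cinfty (fun x => f x *: w).
Proof. by move=> Cf k; exact: Ck_scalel. Qed.

Lemma Cinfty_scaler (V : normedModType R) n a (f : V -> 'rV[R]_n) :
  Cinfty f -> Cinfty (fun x => a *: f x).
Proof.
move=> Cf; apply: Cinfty_row => i.
under eq_fun do rewrite mxE.
by apply: Cinfty_mul; [exact: Cinfty_cst|exact: Cinfty_coordinate].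
Qed.

Lemma Cinfty_row_opp (V : normedModType R) n (f : V -> 'rV[R]_n) :
  Cinfty f -> Cinfty (fun x => - f x).
Proof.
by move=> /(@Cinfty_scaler _ _ (-1)); under eq_fun do rewrite scaleN1r.
Qed.

Lemma Cinfty_coord (V : normedModType R) (f : V -> f24 R) n :
  Cinfty f -> Cinfty (fun x => (f x)$n).
Proof. exact: Cinfty_coordinate. Qed.

Lemma Cinfty_bracket (V : normedModType R) (f g : V -> f24 R) :
  Cinfty f -> Cinfty g -> Cinfty (fun x => f24_bracket (f x) (g x)).
Proof.
move=> Cf Cg; apply: Cinfty_sum => t; apply: Cinfty_scalel.
apply: Cinfty_add; last apply: Cinfty_opp; apply: Cinfty_mul; exact: Cinfty_coord.
Qed.

Lemma Cinfty_bch (V : normedModType R) (f g : V -> f24 R) :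
  Cinfty f -> Cinfty g -> Cinfty (fun x => f24_bch (f x) (g x)).
Proof.
move=> Cf Cg; rewrite /f24_bch /=.
by repeat (apply: Cinfty_add || apply: Cinfty_row_opp || apply: Cinfty_scaler ||
  apply: Cinfty_bracket).
Qed.

Lemma Cinfty_row8 (V : normedModType R) (f1 f2 f3 f4 f5 f6 f7 f8 : V -> R) :
  Cinfty f1 -> Cinfty f2 -> Cinfty f3 -> Cinfty f4 -> Cinfty f5 -> Cinfty f6 ->
  Cinfty f7 -> Cinfty f8 ->
  Cinfty (fun x => row8 (f1 x) (f2 x) (f3 x) (f4 x) (f5 x) (f6 x) (f7 x) (f8 x)).
Proof.
move=> C1 C2 C3 C4 C5 C6 C7 C8; apply: Cinfty_row => -[i lti].
under eq_fun do rewrite mxE /=.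
by case: i lti => [|[|[|[|[|[|[|[|]]]]]]]].
Qed.

Lemma Cinfty_shear (V : normedModType R) (a : V -> R) (f : V -> f24 R) :
  Cinfty a -> Cinfty f -> Cinfty (fun x => shear (a x) (f x)).
Proof.
move=> Ca Cf; have Cn n := Cinfty_coord n Cf.
apply: Cinfty_row8 => //; under eq_fun do rewrite ?expr2.
all: repeat (apply: Cinfty_add || apply: Cinfty_mul || apply: Cinfty_cst) => //.
Qed.

Lemma Cinfty_gmul (V : normedModType R) s (f g : V -> f24 R) :
  Cinfty f -> Cinfty g -> Cinfty (fun x => gmul s (f x) (g x)).
Proof.
move=> Cf Cg; apply: Cinfty_bch => //; apply: Cinfty_shear => //.
by apply: Cinfty_mul; [exact: Cinfty_cst|exact: Cinfty_coord].
Qed.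

Lemma Cinfty_ginv (V : normedModType R) s (f : V -> f24 R) :
  Cinfty f -> Cinfty (fun x => ginv s (f x)).
Proof.
move=> Cf; apply: Cinfty_shear; last exact: Cinfty_row_opp.
apply: Cinfty_opp.
by apply: Cinfty_mul; [exact: Cinfty_cst|exact: Cinfty_coord].
Qed.

Lemma Cinfty_fst n m : Cinfty (fst : 'rV[R]_n * 'rV[R]_m -> 'rV[R]_n).
Proof.
move=> k; apply: (@Ck_linear R _ _ k setT
  (fst : {linear ('rV[R]_n * 'rV[R]_m)%type -> 'rV[R]_n})) => x.
exact: cvg_fst.
Qed.

Lemma Cinfty_snd n m : Cinfty (snd : 'rV[R]_n * 'rV[R]_m -> 'rV[R]_m).
Proof.
move=> k; apply: (@Ck_linear R _ _ k setT
  (snd : {linear ('rV[R]_n * 'rV[R]_m)%type -> 'rV[R]_m})) => x.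
exact: cvg_snd.
Qed.

Lemma Cinfty_line (V : normedModType R) (v : V) : Cinfty (fun t : R => t *: v).
Proof.
apply: Cinfty_scalel => k.
by apply: (@Ck_linear R R R k setT idfun) => x; exact: cvg_id.
Qed.

End Smooth.

(** * Tangent vectors *)

Section Tangent.
Variables (R : realType) (n : nat).
Local Notation M := (model_manifold 'rV[R]_n).

(* Derivation at p in the direction w, with the convention of [velocity] on
   functions that are not smooth. *)
Definition dirv (p w : 'rV[R]_n) : ('rV[R]_n -> R) -> R :=
  fun h => if `[< smooth_fun (M := M) h >] then 'd h p w else 0.

Lemma smooth_funE (h : 'rV[R]_n -> R) : smooth_fun (M := M) h <-> Cinfty h.
Proof. exact: model_smoothE. Qed.

Lemma dirvE p w h : Cinfty h -> dirv p w h = 'd h p w.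
Proof. by rewrite /dirv; case: asboolP => // /smooth_funE. Qed.

Lemma dirvN p w h : ~ Cinfty h -> dirv p w h = 0.
Proof. by rewrite /dirv; case: asboolP => // /smooth_funE. Qed.

(** By the chain rule a velocity depends only on the position and derivative of the curve at 0,
    which identifies tangent vectors with vectors of R^n. *)
Lemma velocityE (c : R -> 'rV[R]_n) : Cinfty c ->
  velocity (M := M) c = dirv (c 0) ('d c 0 1).
Proof.
move=> Cc; apply/funext => h; rewrite /velocity.
have [Ch|nCh] := pselect (Cinfty h); last first.
  by rewrite dirvN //; case: asboolP => // /smooth_funE.
rewrite dirvE//; case: asboolP => [_|/smooth_funE//].
have dh := @Cinfty_differentiable _ _ _ _ (c 0) Ch.
have dc := @Cinfty_differentiable _ _ _ _ (0 : R) Cc.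
rewrite derive1E'; last exact: differentiable_comp.
by rewrite diff_comp.
Qed.

Lemma diff_coordinate i (p v : 'rV[R]_n) :
  'd (fun x : 'rV[R]_n => x 0 i : R) p v = v 0 i.
Proof.
rewrite -deriveE; last exact: differentiable_coord.
have /matrixP/(_ 0 i) := derive_mx (@derivable_id _ _ p v).
by rewrite mxE derive_id => /esym.
Qed.

Lemma dirv_coordinate i (p v : 'rV[R]_n) : dirv p v (fun x => x 0 i) = v 0 i.
Proof.
rewrite dirvE ?diff_coordinate//.
exact: Cinfty_coordinate (@Cinfty_id _ _).
Qed.

(** The coordinate functions are smooth and recover the direction. *)
Lemma dirv_inj p v w : dirv p v = dirv p w -> v = w.
Proof. by move=> E; apply/rowP => i; rewrite -!(dirv_coordinate _ p) E. Qed.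

Lemma dirv_linear p a v w : dirv p (a *: v + w) = a *: dirv p v + dirv p w.
Proof.
apply/funext => h; rewrite [RHS]/= /GRing.scale /= /GRing.add /=.
rewrite /dirv; case: asboolP => _; first exact: linearP.
by rewrite scaler0 addr0.
Qed.

Lemma dirv_comp (f : 'rV[R]_n -> 'rV[R]_n) p v h : Cinfty f -> Cinfty h ->
  dirv p v (h \o f) = dirv (f p) ('d f p v) h.
Proof.
move=> Cf Ch; rewrite !dirvE//; last exact: Cinfty_comp.
have dh := Cinfty_differentiable (f p) Ch.
exact: (congr1 (@^~ v) (diff_comp (Cinfty_differentiable p Cf) dh)).
Qed.

Lemma diff_sum_coord (h : 'rV[R]_n -> R) p v :
  'd h p v = \sum_i v 0 i * 'd h p (delta_mx 0 i).
Proof.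
rewrite {1}(row_sum_delta v) raddf_sum /=; apply: eq_bigr => i _.
by rewrite linearZ.
Qed.

Lemma Cinfty_diff_along (h : 'rV[R]_n -> R) (u : 'rV[R]_n -> 'rV[R]_n) :
  Cinfty h -> Cinfty u -> Cinfty (fun q => 'd h q (u q)).
Proof.
move=> Ch Cu; under eq_fun do rewrite diff_sum_coord.
apply: Cinfty_sum => i; apply: Cinfty_mul; first exact: Cinfty_coordinate.
exact: Cinfty_diff.
Qed.

(** Product rule for a derivative along a moving direction. With the direction frozen at [p], the
    first term is a second derivative, which cancels in a bracket of fields by symmetry. *)
Lemma diff_along (h : 'rV[R]_n -> R) (u : 'rV[R]_n -> 'rV[R]_n) p v :
  Cinfty h -> Cinfty u ->
  'd (fun q => 'd h q (u q)) p v =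
  'd (fun q => 'd h q (u p)) p v + 'd h p ('d u p v).
Proof.
move=> Ch Cu.
have di i := Cinfty_differentiable p (Cinfty_diff (delta_mx 0 i) Ch).
have du i := Cinfty_differentiable p (Cinfty_coordinate i Cu).
(* The expansion is needed twice: for [u] and for the constant direction [u p]. *)
have dE (w : 'rV[R]_n -> 'rV[R]_n)
    (dw : forall i, differentiable (fun q => w q 0 i : R) p) :
    'd (fun q => 'd h q (w q)) p v =
    \sum_i (w p 0 i * 'd (fun q => 'd h q (delta_mx 0 i)) p v +
            'd (fun q => w q 0 i : R) p v * 'd h p (delta_mx 0 i)).
  under eq_fun do rewrite diff_sum_coord.
  pose P i : 'rV[R]_n -> R :=
    (fun q => w q 0 i) * (fun q => 'd h q (delta_mx 0 i)).
  have dP i : differentiable (P i) p := differentiableM (dw i) (di i).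
  have -> : (fun q => \sum_i w q 0 i * 'd h q (delta_mx 0 i)) = \sum_i P i.
    by apply/funext => q; rewrite fct_sumE.
  have dS : differentiable (\sum_i P i) p by exact: differentiable_sum.
  have E1 := deriveE v dS.
  have E2 := @derive_sum _ _ _ n P p v
    (fun i => @diff_derivable _ _ _ _ _ v (dP i)).
  apply: (etrans (esym E1)); apply: (etrans E2); apply: eq_bigr => i _.
  apply: (etrans (deriveE v (dP i))).
  apply: (etrans (congr1 (@^~ v) (diffM (dw i) (di i)))).
  by congr (_ + _); exact: mulrC.
have E1 := dE u du.
have E2 := dE (fun=> u p) (fun i => differentiable_cst _ _).
have E3 := diff_sum_coord h p ('d u p v).
have z i : 'd (fun=> u p 0 i : R) p v = 0.
  exact: (congr1 (@^~ v) (diff_cst (u p 0 i) p)).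
have du' := Cinfty_differentiable p Cu.
have d i : ('d u p v) 0 i = 'd (fun q => u q 0 i : R) p v.
  apply: (etrans _ (deriveE v (du i))).
  apply: (etrans (congr1 (fun M : 'rV[R]_n => M 0 i) (esym (deriveE v du')))).
  have /(congr1 (fun M : 'rV[R]_n => M 0 i)) E :=
    derive_mx (@diff_derivable _ _ _ _ _ v du').
  by apply: (etrans E); rewrite mxE.
have aux (w a b c z' d' : 'I_n -> R) :
    (forall i, z' i = 0) -> (forall i, d' i = b i) ->
    \sum_i (w i * a i + b i * c i) =
    \sum_i (w i * a i + z' i * c i) + \sum_i d' i * c i.
  move=> z0 db; rewrite -big_split; apply: eq_bigr => i _ /=.
  by rewrite z0 db mul0r addr0.
exact: (etrans E1 (etrans (aux _ _ _ _ _ _ z d) (esym (congr2 +%R E2 E3)))).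
Qed.

(** A differential may be computed along any convenient curve with the right velocity. *)
Lemma diff_along_curve m (f : 'rV[R]_n -> 'rV[R]_m) (c : R -> 'rV[R]_n) p w :
  Cinfty f -> Cinfty c -> c 0 = p -> 'd c 0 1 = w ->
  'd f p w = 'd (f \o c) 0 1.
Proof.
move=> Cf Cc <- <-; apply: esym.
have dc := Cinfty_differentiable (0 : R) Cc.
exact: (congr1 (@^~ (1 : R)) (diff_comp dc (Cinfty_differentiable (c 0) Cf))).
Qed.

(** Differentials are read off from first-order expansions; the remainder [r] may be any smooth
    curve. *)
Lemma diff_quadratic_curve (a b : 'rV[R]_n) (r : R -> 'rV[R]_n) :
  Cinfty r -> 'd (fun t : R => a + t *: b + t ^+ 2 *: r t) 0 1 = b.
Proof.
move=> Cr; apply/rowP => i.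
have Ct : Cinfty (fun t : R => t).
  by move=> k; apply: (@Ck_linear R R R k setT idfun) => x; exact: cvg_id.
have C1 : Cinfty (fun t : R => a + t *: b + t ^+ 2 *: r t).
  apply: Cinfty_add.
    by apply: Cinfty_add; [exact: Cinfty_cst|exact: Cinfty_line].
  apply: Cinfty_row => j; under eq_fun do rewrite mxE expr2.
  by apply: Cinfty_mul; [exact: Cinfty_mul|exact: Cinfty_coordinate].
have dC := Cinfty_differentiable (0 : R) C1.
have dri := Cinfty_differentiable (0 : R) (Cinfty_coordinate i Cr).
have Dr := derivableP (@diff_derivable _ _ _ _ _ (1 : R) dri).
have Di := @is_derive_id R R (0 : R) (1 : R).
have D1 := is_deriveD (is_derive_cst (a 0 i) (0 : R) (1 : R))
  (is_deriveM Di (is_derive_cst (b 0 i) (0 : R) (1 : R))).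
have D2 := is_deriveM (is_deriveM Di Di) Dr.
have DF : is_derive (0 : R) (1 : R) (cst (a 0 i) + ((@id R) * cst (b 0 i)) +
    ((@id R) * (@id R) * (fun t => r t 0 i))) (b 0 i).
  apply: is_derive_eq (is_deriveD D1 D2) _.
  set d := derive _ _ _.
  change (0 + (0 * 0 + b 0 i * 1) +
    (0 * 0 * d + r 0 0 i * (0 * 1 + 0 * 1)) = b 0 i).
  ring.
rewrite -(deriveE (1 : R) dC).
have /(congr1 (fun M : 'rV[R]_n => M 0 i)) E :=
    derive_mx (@diff_derivable _ _ _ _ _ (1 : R) dC).
apply: (etrans E); rewrite mxE.
case: DF => _; apply: etrans; apply: (congr1 (fun f : R -> R => derive f 0 1)).
by apply/funext => t; rewrite !mxE expr2.
Qed.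

End Tangent.

(** * Left-invariant vector fields *)

Section Group.
Variables (R : realType) (s : R).
Implicit Types (p q v w : f24 R) (h : f24 R -> R).

(** The manifold and the polarisation are literally those of [F24], which makes the identity map a
    contactomorphism; what remains to be proved is that the polarisation is invariant under the new
    product. *)
Definition twisted_F24 : polarised_group R :=
  @PolarisedGroup R 8 (F24_manifold R) (gmul s) 0 (ginv s)
    (@pg_polarisation R (F24 R)).

Lemma Cinfty_gmull a : Cinfty (gmul s a).
Proof. apply: Cinfty_gmul; [exact: Cinfty_cst|exact: Cinfty_id]. Qed.

Lemma twisted_is_lie_group : is_lie_group twisted_F24.
Proof.
split; first exact: model_is_manifold.
- split; [exact: gmulA|exact: gmul0x|exact: gmulVx].
- apply/prod_model_smoothE; apply: Cinfty_gmul.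
  + exact: Cinfty_fst.
  + exact: Cinfty_snd.
- apply/model_smoothE; apply: Cinfty_ginv; exact: Cinfty_id.
Qed.

(* Only the terms of the BCH series linear in the second variable survive. *)
Definition bch_tangent p v : f24 R :=
  v + 2^-1 *: f24_bracket p v + 12^-1 *: f24_bracket p (f24_bracket p v).

(* The differential at 0 of the left translation by p. *)
Definition translate_tangent p v := bch_tangent p (shear (s * p$1) v).

(** The truncated series has degree at most two in its second argument, so the remainder is exactly
    t^2 times a constant vector. *)
Lemma bch_line p v (t : R) : f24_bch p (t *: v) =
  p + t *: bch_tangent p v + t ^+ 2 *: (12^-1 *: f24_bracket v (f24_bracket v p)
    - 24^-1 *: f24_bracket v (f24_bracket p (f24_bracket p v))).
Proof.
rewrite /bch_tangent (row8_eta p) (row8_eta v).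
by rewrite !row8E; congr row8; field.
Qed.

Lemma gmul_line p v (t : R) :
  gmul s p (t *: v) = f24_bch p (t *: shear (s * p$1) v).
Proof.
rewrite /gmul; congr f24_bch.
by rewrite (row8_eta v); rewrite !row8E; congr row8; ring.
Qed.

Lemma Cinfty_bch_line p v : Cinfty (fun t : R => f24_bch p (t *: v)).
Proof. by apply: Cinfty_bch; [exact: Cinfty_cst|exact: Cinfty_line]. Qed.

Lemma diff_bch_line p v :
  'd (fun t : R => f24_bch p (t *: v)) 0 1 = bch_tangent p v.
Proof.
under eq_fun do rewrite bch_line.
by apply: diff_quadratic_curve; exact: Cinfty_cst.
Qed.

Lemma diff_gmul_line p v :
  'd (fun t : R => gmul s p (t *: v)) 0 1 = translate_tangent p v.
Proof. by under eq_fun do rewrite gmul_line; exact: diff_bch_line. Qed.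

Lemma Cinfty_gmul_line p v : Cinfty (fun t : R => gmul s p (t *: v)).
Proof. by apply: Cinfty_gmul; [exact: Cinfty_cst|exact: Cinfty_line]. Qed.

Lemma velocity_bch p v :
  velocity (M := F24_manifold R) (fun t => f24_bch p (t *: v)) =
  dirv p (bch_tangent p v).
Proof.
rewrite (velocityE (Cinfty_bch_line p v)) diff_bch_line.
by rewrite scale0r bchx0.
Qed.

Lemma velocity_gmul p v :
  velocity (M := F24_manifold R) (fun t => gmul s p (t *: v)) =
  dirv p (translate_tangent p v).
Proof.
rewrite (velocityE (Cinfty_gmul_line p v)) diff_gmul_line.
by rewrite scale0r gmulx0.
Qed.

Lemma translate_tangent0 v : translate_tangent 0 v = v.
Proof.
rewrite /translate_tangent /bch_tangent coord0 mulr0 shear0.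
by rewrite (row8_eta v) row8_0 !row8E; congr row8; ring.
Qed.

(** By associativity, left translation by [a] maps the curve [gmul s p (t *: v)] to the
    corresponding curve through [gmul s a p]. *)
Lemma diff_gmull a p v :
  'd (gmul s a) p (translate_tangent p v) = translate_tangent (gmul s a p) v.
Proof.
have c0 : gmul s p ((0 : R) *: v) = p by rewrite scale0r gmulx0.
apply: (etrans (diff_along_curve (Cinfty_gmull a) (Cinfty_gmul_line p v) c0
  (diff_gmul_line p v))).
apply: (etrans _ (diff_gmul_line (gmul s a p) v)).
apply: (congr1 (fun f : R -> f24 R => 'd f 0 1)).
by apply/funext => t; rewrite /= gmulA.
Qed.

Definition left_field v : (f24 R -> R) -> (f24 R -> R) :=
  fun h p => dirv p (translate_tangent p v) h.

(** Fields vanish on functions that are not smooth, so invariance also requires that translations,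
    being invertible, keep such functions non-smooth. *)
Lemma Cinfty_gmull_comp a h : Cinfty (h \o gmul s a) <-> Cinfty h.
Proof.
split=> Ch; last exact: Cinfty_comp (Cinfty_gmull a) Ch.
rewrite (_ : h = (h \o gmul s a) \o gmul s (ginv s a)).
  exact: Cinfty_comp (Cinfty_gmull _) Ch.
by apply/funext => x; rewrite /= gmulVKx.
Qed.

Lemma left_field_invariant v a h :
  left_field v (h \o gmul s a) = left_field v h \o gmul s a.
Proof.
apply/funext => p; rewrite /left_field /=.
have [Ch|nCh] := pselect (Cinfty h).
  by rewrite dirv_comp//; [rewrite diff_gmull|exact: Cinfty_gmull].
by rewrite !dirvN// => /Cinfty_gmull_comp.
Qed.

Lemma Cinfty_translate_tangent v : Cinfty (translate_tangent ^~ v).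
Proof.
have Cv : Cinfty (fun p => shear (s * p$1) v).
  apply: Cinfty_shear; last exact: Cinfty_cst.
  apply: Cinfty_mul; first exact: Cinfty_cst.
  exact: (Cinfty_coord 1 (@Cinfty_id R 8)).
by rewrite /translate_tangent /bch_tangent;
  repeat (apply: Cinfty_add || apply: Cinfty_scaler || apply: Cinfty_bracket ||
          exact: Cv || exact: Cinfty_id).
Qed.

Lemma left_fieldE v h : Cinfty h ->
  left_field v h = (fun p => 'd h p (translate_tangent p v)).
Proof. by move=> Ch; apply/funext => p; rewrite /left_field dirvE. Qed.

Lemma left_fieldN v h : ~ Cinfty h -> left_field v h = cst 0.
Proof. by move=> Ch; apply/funext => p; rewrite /left_field dirvN. Qed.

Lemma Cinfty_left_field v h : Cinfty h -> Cinfty (left_field v h).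
Proof.
by move=> Ch; rewrite left_fieldE//; apply: Cinfty_diff_along => //;
  exact: Cinfty_translate_tangent.
Qed.

Lemma left_field_lie_algebra v : @lie_algebra R twisted_F24 (left_field v).
Proof.
split; last by move=> a h; exact: left_field_invariant.
split=> [p|h].
  exists (fun t : R => gmul s p (t *: v)); split.
  - by apply/model_smoothE; exact: Cinfty_gmul_line.
  - by rewrite scale0r gmulx0.
  - by rewrite velocity_gmul; apply/funext.
by move=> /smooth_funE Ch; apply/smooth_funE; exact: Cinfty_left_field.
Qed.

(** Applying the field to the coordinate functions gives its value at 0 as a vector; on the Lie
    algebra this is the inverse of [left_field]. *)
Definition field_at0 (X : (f24 R -> R) -> (f24 R -> R)) : f24 R :=
  \row_i X (fun x => x 0 i) 0.

Lemma left_fieldK : cancel left_field field_at0.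
Proof.
move=> v; apply/rowP => i; rewrite mxE /left_field translate_tangent0.
exact: dirv_coordinate.
Qed.

(** Invariance gives the field at [p] from its value at 0, applied to [h \o gmul s p]. *)
Lemma lie_algebra_left_field X : @lie_algebra R twisted_F24 X ->
  X = left_field (field_at0 X).
Proof.
move=> [[tX _] lX].
have [c [/model_smoothE Cc c0 vE]] := tX 0.
have XE h : X h 0 = dirv 0 ('d c 0 1) h.
  apply: (etrans (congr1 (@^~ h) vE)).
  apply: (etrans (congr1 (@^~ h) (velocityE Cc))).
  exact: (congr1 (fun p => dirv p ('d c 0 1) h) c0).
have -> : field_at0 X = 'd c 0 1.
  by apply/rowP => i; rewrite mxE XE dirv_coordinate.
apply/funext => h; apply/funext => p.
have /(congr1 (@^~ 0)) /= := lX p h; rewrite gmulx0 => <-.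
have /(congr1 (@^~ 0)) /= := left_field_invariant ('d c 0 1) p h.
by rewrite gmulx0 => <-; rewrite /left_field translate_tangent0 XE.
Qed.

(** The derivation D with D e1 = e2 and D e2 = 0; the Leibniz rule then forces D e4 = e5, D e6 = 2
    e7, D e7 = e8 and 0 on e3, e5, e8. *)
Definition derivation v : f24 R :=
  row8 0 v$1 0 0 v$4 0 (2 * v$6) v$7.

(* The bracket of v + s v_1 D and w + s w_1 D in f24 + <D>, projected to f24. *)
Definition gbracket v w : f24 R :=
  f24_bracket v w + s *: (v$1 *: derivation w - w$1 *: derivation v).

(** The BCH product contributes half of the bracket and the twist contributes the derivation;
    antisymmetrising in [v] and [w] gives [gbracket]. *)
Lemma diff_translate_tangent v w :
  'd (translate_tangent ^~ w) 0 v =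
  2^-1 *: f24_bracket v w + (s * v$1) *: derivation w.
Proof.
(* The part of order two and higher along the line t v: the quadratic term of the shear, its cross
   term with the bracket, and the double bracket. *)
pose r (t : R) : f24 R := (s * v$1) ^+ 2 *: row8 0 0 0 0 0 0 0 w$6
  + (2^-1 * (s * v$1)) *: f24_bracket v (derivation w)
  + 12^-1 *: f24_bracket v (f24_bracket v (shear (t * (s * v$1)) w)).
have E : (translate_tangent ^~ w) \o (fun t : R => t *: v) = fun t : R =>
    w + t *: (2^-1 *: f24_bracket v w + (s * v$1) *: derivation w)
      + t ^+ 2 *: r t.
  apply/funext => t; rewrite /= /r /translate_tangent /bch_tangent /derivation.
  rewrite coordZ (row8_eta v) (row8_eta w) !coord_row8 !row8E.
  by congr row8; ring.
have Cr : Cinfty r.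
  apply: Cinfty_add; first exact: Cinfty_cst.
  apply: Cinfty_scaler; do 2 (apply: Cinfty_bracket; first exact: Cinfty_cst).
  apply: Cinfty_shear; last exact: Cinfty_cst.
  exact: (Cinfty_line (s * v$1 : R)).
have c0 : (0 : R) *: v = 0 by rewrite scale0r.
have c1 : 'd (fun t : R => t *: v) 0 1 = v.
  case: (is_diff_scalel (0 : R) v) => _ dE.
  by apply: (etrans (congr1 (@^~ (1 : R)) dE)); rewrite scale1r.
apply: (etrans (diff_along_curve (Cinfty_translate_tangent w)
  (Cinfty_line v) c0 c1)).
apply: (etrans (congr1 (fun f : R -> f24 R => 'd f 0 1) E)).
exact: diff_quadratic_curve.
Qed.

Lemma left_field_bracket v w :
  vf_bracket (left_field v) (left_field w) = left_field (gbracket v w).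
Proof.
apply/funext => h; have [Ch|nCh] := pselect (Cinfty h); last first.
  (* On a function that is not smooth every [left_field] gives 0, and differentiating 0 gives 0
     again. *)
  apply/funext => p; rewrite /vf_bracket !(left_fieldN _ nCh).
  have C0 : Cinfty (cst 0 : f24 R -> R) by exact: Cinfty_cst.
  rewrite !left_fieldE// /cst.
  have E := diff_cst (0 : R) p; rewrite !(congr1 (@^~ _) E) /=; exact: subr0.
(* By left invariance it suffices to compare the two fields at 0, where the
   second-order parts cancel by Schwarz's theorem. *)
suff key k : Cinfty k ->
    vf_bracket (left_field v) (left_field w) k 0 =
    left_field (gbracket v w) k 0.
  apply/funext => p.
  have inv u g : left_field u (g \o gmul s p) 0 = left_field u g p.
    apply: (etrans (congr1 (@^~ 0) (left_field_invariant u p g))).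
    exact: (congr1 (left_field u g) (gmulx0 s p)).
  have inv2 u u' : left_field u (left_field u' (h \o gmul s p)) 0 =
      left_field u (left_field u' h) p.
    apply: (etrans (congr1 (fun g => left_field u g 0)
      (left_field_invariant u' p h))).
    exact: inv.
  have K := key _ ((Cinfty_gmull_comp p h).2 Ch).
  apply: (etrans (esym (congr2 (fun x y => x - y) (inv2 v w) (inv2 w v)))).
  exact: (etrans K (inv _ _)).
move=> Ck; rewrite /vf_bracket.
have E u u' : left_field u (left_field u' k) 0 =
    'd (fun q => 'd k q u') 0 u +
    'd k 0 (2^-1 *: f24_bracket u u' + (s * u$1) *: derivation u').
  apply: (etrans (dirvE _ _ (Cinfty_left_field u' Ck))).
  rewrite translate_tangent0 (left_fieldE u' Ck).
  apply: (etrans (diff_along 0 u Ck (Cinfty_translate_tangent u'))).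
  apply: congr2; first by rewrite translate_tangent0.
  exact: (congr1 ('d k 0) (diff_translate_tangent u u')).
have S := schwarz 0 v w (Ck 2%N).
apply: (etrans (congr2 (fun x y => x - y) (E v w) (E w v))).
apply: (etrans _ (esym (dirvE _ _ Ck))); rewrite translate_tangent0.
apply: (etrans (congr1 (fun x => x + _ - _) (esym S))).
rewrite opprD addrACA subrr add0r -linearB; congr ('d k 0 _).
rewrite /gbracket /derivation (row8_eta v) (row8_eta w) !coord_row8 !row8E.
by congr row8; field.
Qed.

End Group.

(** * The twisted groups as polarised groups *)

Section Strata.
Variable R : realType.
Implicit Types (v w : f24 R).

Lemma f24_basisE :
  (f24_basis R 1 = row8 1 0 0 0 0 0 0 0) *
  (f24_basis R 2 = row8 0 1 0 0 0 0 0 0) *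
  (f24_basis R 3 = row8 0 0 1 0 0 0 0 0) *
  (f24_basis R 4 = row8 0 0 0 1 0 0 0 0) *
  (f24_basis R 5 = row8 0 0 0 0 1 0 0 0) *
  (f24_basis R 6 = row8 0 0 0 0 0 1 0 0) *
  (f24_basis R 7 = row8 0 0 0 0 0 0 1 0) *
  (f24_basis R 8 = row8 0 0 0 0 0 0 0 1).
Proof. by do !split; apply: f24_ext; rewrite coord_basis// coord_row8. Qed.

Lemma stratum1P v : v \in f24_stratum R (-1) <-> v = row8 v$1 v$2 0 0 0 0 0 0.
Proof.
rewrite /f24_stratum /= span_cons span_seq1 !f24_basisE; split=> [|->].
  move=> /memv_addP[u1 /vlineP[a ->]] [u2 /vlineP[b ->]] ->.
  by rewrite !row8E !coord_row8; congr row8; ring.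
apply/memv_addP; exists (v$1 *: row8 1 0 0 0 0 0 0 0).
  exact/memvZ/memv_line.
exists (v$2 *: row8 0 1 0 0 0 0 0 0); first exact/memvZ/memv_line.
by rewrite !row8E; congr row8; ring.
Qed.

Lemma stratum2P v : v \in f24_stratum R (-2) <-> v = row8 0 0 v$3 0 0 0 0 0.
Proof.
rewrite /f24_stratum /= span_seq1 !f24_basisE; split=> [|->].
  by move=> /vlineP[a ->]; rewrite !row8E !coord_row8; congr row8; ring.
by apply/vlineP; exists v$3; rewrite !row8E; congr row8; ring.
Qed.

Lemma stratum3P v : v \in f24_stratum R (-3) <-> v = row8 0 0 0 v$4 v$5 0 0 0.
Proof.
rewrite /f24_stratum /= span_cons span_seq1 !f24_basisE; split=> [|->].
  move=> /memv_addP[u1 /vlineP[a ->]] [u2 /vlineP[b ->]] ->.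
  by rewrite !row8E !coord_row8; congr row8; ring.
apply/memv_addP; exists (v$4 *: row8 0 0 0 1 0 0 0 0).
  exact/memvZ/memv_line.
exists (v$5 *: row8 0 0 0 0 1 0 0 0); first exact/memvZ/memv_line.
by rewrite !row8E; congr row8; ring.
Qed.

Lemma stratum4P v : v \in f24_stratum R (-4) <-> v = row8 0 0 0 0 0 v$6 v$7 v$8.
Proof.
rewrite /f24_stratum /= !span_cons span_nil addv0 !f24_basisE; split=> [|->].
  move=> /memv_addP[u1 /vlineP[a ->]].
  move=> [_ /memv_addP[u2 /vlineP[b ->]] [u3 /vlineP[c ->]] -> ->].
  by rewrite !row8E !coord_row8; congr row8; ring.
apply/memv_addP; exists (v$6 *: row8 0 0 0 0 0 1 0 0).
  exact/memvZ/memv_line.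
exists (v$7 *: row8 0 0 0 0 0 0 1 0 + v$8 *: row8 0 0 0 0 0 0 0 1).
  by apply: memv_add; exact/memvZ/memv_line.
by rewrite !row8E; congr row8; ring.
Qed.

Lemma shear_stratum1 t v :
  v \in f24_stratum R (-1) -> shear t v \in f24_stratum R (-1).
Proof.
move=> /stratum1P ->; apply/stratum1P.
by rewrite !row8E !coord_row8; congr row8; ring.
Qed.

End Strata.

Section PolarisedGroup.
Variables (R : realType) (s : R).
Implicit Types (p q v w : f24 R) (h : f24 R -> R).
Local Notation G := (twisted_F24 s).
Local Notation polarisation := (@pg_polarisation R G).

Lemma F24_twisted0 : F24 R = twisted_F24 0.
Proof. by rewrite /twisted_F24 gmul_0 ginv_0. Qed.

(** At [p] the two products differ by the shear of parameter s p_1, which preserves the first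
    stratum; hence both translate it to the same subspace. *)
Lemma polarisationE p : polarisation p =
  [set dirv p (translate_tangent s p v) |
    v in [set v | v \in f24_stratum R (-1)]].
Proof.
apply/seteqP; split=> _ [v /= vS <-].
  exists (shear (- (s * p$1)) v); first exact: shear_stratum1.
  by rewrite /translate_tangent -shearD subrr shear0 velocity_bch.
exists (shear (s * p$1) v); first exact: shear_stratum1.
by rewrite velocity_bch.
Qed.

Lemma translate_tangent_linear p a v w : translate_tangent s p (a *: v + w) =
  a *: translate_tangent s p v + translate_tangent s p w.
Proof.
rewrite /translate_tangent /bch_tangent.
rewrite (row8_eta p) (row8_eta v) (row8_eta w) !coord_row8 !row8E.
by congr row8; ring.
Qed.

Lemma left_field_linear a v w : left_field s (a *: v + w) =
  a *: left_field s v + left_field s w.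
Proof.
apply/funext => h; apply/funext => p.
rewrite /left_field translate_tangent_linear.
exact: (congr1 (@^~ h) (dirv_linear p a _ _)).
Qed.

Lemma left_field_push p a v :
  push_vector (gmul s a) (dirv p (translate_tangent s p v)) =
  dirv (gmul s a p) (translate_tangent s (gmul s a p) v).
Proof.
by apply/funext => h; exact: (congr1 (@^~ p) (left_field_invariant s v a h)).
Qed.

Lemma twisted_left_invariant_polarisation : left_invariant_polarisation G.
Proof.
split=> [p|p|a p].
- rewrite polarisationE => _ [v vS <-].
  exists (fun t : R => gmul s p (t *: v)); split.
  + by apply/model_smoothE; exact: Cinfty_gmul_line.
  + by rewrite scale0r gmulx0.
  + by rewrite velocity_gmul.
- rewrite polarisationE; split.
    exists 0; first exact: mem0v.
    have := translate_tangent_linear p (-1) 0 0.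
    rewrite scaleN1r oppr0 addr0 scaleN1r addNr => ->.
    have := dirv_linear p (-1) 0 0.
    by rewrite scaleN1r oppr0 addr0 scaleN1r addNr.
  move=> a _ _ [v vS <-] [w wS <-]; exists (a *: v + w).
    by apply: memvD => //; exact: memvZ.
  by rewrite translate_tangent_linear dirv_linear.
- rewrite !polarisationE; apply/seteqP; split=> _ [v vS <-].
    exists (dirv p (translate_tangent s p v)); first by exists v.
    exact: left_field_push.
  case: vS => w wS <-; exists w => //; apply/esym; exact: left_field_push.
Qed.

Lemma bracket_closed_full (A : set (f24 R)) : linear_subspace A ->
  (forall v w, A v -> A w -> A (gbracket s v w)) ->
  A (row8 1 0 0 0 0 0 0 0) -> A (row8 0 1 0 0 0 0 0 0) -> forall v, A v.
Proof.
move=> [A0 AL] AB A1 A2.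
have AZ a v : A v -> A (a *: v) by move=> Av; rewrite -[_ *: _]addr0; exact: AL.
have AD v w : A v -> A w -> A (v + w).
  by move=> Av Aw; rewrite -[v]scale1r; exact: AL.
have brE := (row8E, coord_row8).
have A3 : A (row8 0 0 1 0 0 0 0 0).
  have := AB _ _ A2 A1; rewrite /gbracket /derivation !brE.
  congr A; congr row8; ring.
have A4 : A (row8 0 0 0 1 0 0 0 0).
  have := AB _ _ A3 A1; rewrite /gbracket /derivation !brE.
  congr A; congr row8; ring.
have A5 : A (row8 0 0 0 0 1 0 0 0).
  have := AB _ _ A3 A2; rewrite /gbracket /derivation !brE.
  congr A; congr row8; ring.
have A7 : A (row8 0 0 0 0 0 0 1 0).
  have := AB _ _ A5 A1; rewrite /gbracket /derivation !brE.
  congr A; congr row8; ring.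
have A8 : A (row8 0 0 0 0 0 0 0 1).
  have := AB _ _ A5 A2; rewrite /gbracket /derivation !brE.
  congr A; congr row8; ring.
(* The twisted bracket of e4 and e1 is e6 - s e5, so e5 has to be available first and is added
   back. *)
have A6 : A (row8 0 0 0 0 0 1 0 0).
  have := AD _ _ (AB _ _ A4 A1) (AZ s _ A5); rewrite /gbracket /derivation !brE.
  congr A; congr row8; ring.
move=> v.
have := AD _ _ (AZ v$1 _ A1) (AD _ _ (AZ v$2 _ A2) (AD _ _ (AZ v$3 _ A3)
  (AD _ _ (AZ v$4 _ A4) (AD _ _ (AZ v$5 _ A5) (AD _ _ (AZ v$6 _ A6)
  (AD _ _ (AZ v$7 _ A7) (AZ v$8 _ A8))))))).
rewrite [in X in _ -> X](row8_eta v) !row8E.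
by congr A; congr row8; ring.
Qed.

Lemma horizontalE : @horizontal R G =
  [set left_field s v | v in [set v | v \in f24_stratum R (-1)]].
Proof.
apply/seteqP; split=> [X [LX]|_ [v vS <-]].
  rewrite polarisationE (lie_algebra_left_field LX) => -[v vS /dirv_inj].
  rewrite !translate_tangent0 => E; exists v => //.
  by rewrite E.
split; first exact: left_field_lie_algebra.
by rewrite polarisationE; exists v.
Qed.

Lemma twisted_bracket_generating : bracket_generating G.
Proof.
move=> A [A0 AL] AB hA X /lie_algebra_left_field ->.
apply: (@bracket_closed_full [set v | A (left_field s v)]).
- split=> [|a v w Av Aw] /=; last by rewrite left_field_linear; exact: AL.
  have := hA (left_field s 0); apply; rewrite horizontalE; exists 0 => //.
  exact: mem0v.
- by move=> v w Av Aw /=; rewrite -left_field_bracket; exact: AB.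
- apply: hA; rewrite horizontalE; eexists; last reflexivity.
  by apply/stratum1P; rewrite !coord_row8.
- apply: hA; rewrite horizontalE; eexists; last reflexivity.
  by apply/stratum1P; rewrite !coord_row8.
Qed.

Lemma twisted_is_polarised_lie_group : is_polarised_lie_group G.
Proof.
split.
- exact: twisted_is_lie_group.
- exact: normed_connected.
- exact: twisted_left_invariant_polarisation.
- exact: twisted_bracket_generating.
Qed.

Lemma field_at0_linear a (X Y : (f24 R -> R) -> (f24 R -> R)) :
  field_at0 (a *: X + Y) = a *: field_at0 X + field_at0 Y.
Proof. by apply/rowP => i; rewrite !mxE. Qed.

Lemma field_at0_iso :
  lie_algebra_iso (@lie_algebra R G) (@vf_bracket R G) setT (gbracket s)
    (@field_at0 R).
Proof.
split.
- by move=> a X Y _ _; exact: field_at0_linear.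
- move=> X Y /lie_algebra_left_field EX /lie_algebra_left_field EY.
  by rewrite [in LHS]EX [in LHS]EY left_field_bracket left_fieldK.
- split=> //.
    move=> X Y /set_mem LX /set_mem LY E.
    by rewrite (lie_algebra_left_field LX) (lie_algebra_left_field LY) E.
  move=> v _; exists (left_field s v); first exact: left_field_lie_algebra.
  exact: left_fieldK.
Qed.

Lemma field_at0_horizontal :
  @field_at0 R @` @horizontal R G = [set v | v \in f24_stratum R (-1)].
Proof.
rewrite horizontalE image_comp; apply/seteqP; split=> [_ [v vS <-]|v vS].
  by rewrite /= left_fieldK.
by exists v => //=; rewrite left_fieldK.
Qed.

Lemma is_subgroup_vanish r : (r <= 8)%N -> is_subgroup (G := G) (vanish r).
Proof.
move=> r8; split.
- by move=> k _; rewrite coord0.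
- by move=> x y; exact: gmul_vanish.
- move=> x x0 k /andP[k0 kr]; have {r8} := leq_trans kr r8.
  have {}x0 j : (0 < j <= k)%N -> x$j = 0.
    by case/andP=> j0 jk; rewrite x0// j0 (leq_trans jk).
  rewrite /= (row8_eta x) !row8E.
  case: k k0 {kr} x0 => [|[|[|[|[|[|[|[|[|k]]]]]]]]]// _ x0 _.
  all: rewrite ?coord_row8.
  all: rewrite ?(x0 1) ?(x0 2) ?(x0 3) ?(x0 4) ?(x0 5) ?(x0 6) ?(x0 7) ?(x0 8)//.
  all: by ring.
Qed.

(** As [vanish r'] is a subgroup, only the generating commutators need checking. *)
Lemma lower_central_vanish m r r' : (r' <= 8)%N ->
  (forall x y, vanish r x -> vanish r' (gcomm s x y)) ->
  @lower_central R G m `<=` vanish r -> @lower_central R G m.+1 `<=` vanish r'.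
Proof.
move=> r8 step sub z /= gz; apply: gz; first exact: is_subgroup_vanish.
by move=> _ [x [y [/sub x0 ->]]]; exact: step.
Qed.

Lemma twisted_nilpotent : nilpotent_group G.
Proof.
exists 6%N; apply/seteqP; split=> [x|_ ->].
  move=> Lx; apply: vanish8; move: x Lx.
  apply: (@lower_central_vanish _ 7) => //; first exact: gcomm_vanish8.
  apply: (@lower_central_vanish _ 6) => //; first exact: gcomm_vanish7.
  apply: (@lower_central_vanish _ 4) => //; first exact: gcomm_vanish6.
  apply: (@lower_central_vanish _ 3) => //; first exact: gcomm_vanish4.
  apply: (@lower_central_vanish _ 2) => //; first exact: gcomm_vanish3.
  apply: (@lower_central_vanish _ 0) => //.
    by move=> x y _; exact: gcomm_vanish2.
  by move=> x _ [|k]; rewrite // andbF.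
by move=> K [K1 _ _] _.
Qed.

End PolarisedGroup.

(** * Comparison of the twisted group with F24 *)

Section Comparison.
Variable R : realType.

(** An isomorphism commutes with [gcomm], so it would send the nonzero element of [gcomm4_1] to 0 by
    [gcomm4_0]. *)
Lemma twisted1_not_isomorphic :
  ~ lie_group_isomorphic (twisted_F24 (1 : R)) (twisted_F24 (0 : R)).
Proof.
move=> [f [_ [g [_ fK gK]]] fM'].
have fM (x y : f24 R) : f (gmul 1 x y) = gmul 0 (f x) (f y) := fM' x y.
have f0 : f (0 : f24 R) = 0.
  have E : gmul 0 (f 0) (f 0) = f 0 by rewrite -fM gmul0x.
  by rewrite -[LHS](gmulKx 0 (f 0)) E gmulVx.
have fV x : f (ginv 1 x) = ginv 0 (f x).
  rewrite -[LHS](gmulx0 0) -(gmulxV 0 (f x)) (gmulA 0) -fM.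
  by rewrite gmulVx f0 gmul0x.
have fC x y : f (gcomm 1 x y) = gcomm 0 (f x) (f y).
  by rewrite /gcomm -!fV -!fM.
have := @gcomm4_1 R; apply.
by apply: (can_inj fK); rewrite !fC gcomm4_0 f0.
Qed.

Lemma twisted_contactomorphic (s s' : R) :
  globally_contactomorphic (twisted_F24 s) (twisted_F24 s').
Proof.
exists id.
  have Cid : smooth_map (M := F24_manifold R) (N := F24_manifold R) id.
    by apply/model_smoothE; exact: Cinfty_id.
  by split => //; exists id.
by move=> p; rewrite image_id.
Qed.

Lemma F24_characterised : F24_characterisation (F24 R).
Proof.
rewrite F24_twisted0; split; first exact: twisted_is_polarised_lie_group.
  exact: normed_simply_connected.
exists (@field_at0 R); last exact: field_at0_horizontal.
have -> : @f24_bracket R = gbracket 0.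
  by apply/funext => v; apply/funext => w; rewrite /gbracket scale0r addr0.
exact: field_at0_iso.
Qed.
End Comparison.

(** * The prolongation and the modification *)

Section Prolongation.
Variable R : realType.
Implicit Types (v w x y : f24 R) (a b : R).

Lemma derivation_linear : linear (@derivation R).
Proof.
move=> a v w; rewrite /derivation !coordD !coordZ !row8E.
by congr row8; ring.
Qed.
HB.instance Definition _ :=
  GRing.isLinear.Build R (f24 R) (f24 R) *:%R (@derivation R) derivation_linear.

Lemma derivation_row8 (x1 x2 x3 x4 x5 x6 x7 x8 : R) :
  derivation (row8 x1 x2 x3 x4 x5 x6 x7 x8) = row8 0 x1 0 0 x4 0 (2 * x6) x7.
Proof. by rewrite /derivation !coord_row8. Qed.

Definition g0 : {vspace 'End(f24 R)} := <[linfun (@derivation R)]>%VS.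

Lemma g0P (D : 'End(f24 R)) :
  D \in g0 <-> exists a, forall x, D x = a *: derivation x.
Proof.
split=> [/vlineP[a ->]|[a Da]].
  by exists a => x; rewrite scale_lfunE lfunE.
by apply/vlineP; exists a; apply/lfunP => x; rewrite Da scale_lfunE lfunE.
Qed.

Lemma g0_der_subalgebra : der_subalgebra g0.
Proof.
split=> [u /g0P[a uE] x y|u /g0P[a uE] x /stratum1P ->|
    u v /g0P[a uE] /g0P[b vE]].
- rewrite !uE (row8_eta x) (row8_eta y) !(derivation_row8, row8E).
  by congr row8; ring.
- rewrite uE derivation_row8 row8E; apply/stratum1P; rewrite !coord_row8.
  by congr row8; ring.
- apply/g0P; exists 0 => x.
  rewrite scale0r add_lfunE opp_lfunE !comp_lfunE !uE !vE.
  rewrite [derivation (b *: _)]linearZ [derivation (a *: _)]linearZ /=.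
  by rewrite !scalerA mulrC subrr.
Qed.

Local Notation P := (f24 R * R^o)%type.

(* (x, a) stands for x + a D. *)
Definition pbracket (u v : P) : P :=
  (f24_bracket u.1 v.1 + u.2 *: derivation v.1 - v.2 *: derivation u.1, 0).

Lemma pbracket_lie : lie_bracket pbracket.
Proof.
split.
- move=> a [x a1] [y a2] [z a3]; rewrite /pbracket /=; congr pair; last first.
    by rewrite /= scaler0 addr0.
  rewrite /= (row8_eta x) (row8_eta y) (row8_eta z) !(derivation_row8, row8E).
  by congr row8; rewrite /GRing.scale /=; ring.
- move=> a [x a1] [y a2] [z a3]; rewrite /pbracket /=; congr pair; last first.
    by rewrite /= scaler0 addr0.
  rewrite /= (row8_eta x) (row8_eta y) (row8_eta z) !(derivation_row8, row8E).
  by congr row8; rewrite /GRing.scale /=; ring.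
- move=> [x a]; rewrite /pbracket /=; congr pair.
  by rewrite (row8_eta x) row8_0 !(derivation_row8, row8E); congr row8; ring.
- move=> [x a1] [y a2] [z a3]; rewrite /pbracket /=; congr pair; last first.
    by rewrite /= !addr0.
  rewrite /= (row8_eta x) (row8_eta y) (row8_eta z) !(derivation_row8, row8E).
  rewrite row8_0; by congr row8; ring.
Qed.

Definition embed (x : f24 R) : P := (x, 0).
Lemma embed_linear : linear embed.
Proof. by move=> a x y; congr pair; rewrite /= scaler0 addr0. Qed.
HB.instance Definition _ :=
  GRing.isLinear.Build R (f24 R) P *:%R embed embed_linear.

(** The vector x + x_1 D; such vectors make up the modification. *)
Definition graph (x : f24 R) : P := (x, x$1).
Lemma graph_linear : linear graph.
Proof. by move=> a x y; congr pair; rewrite coordD coordZ. Qed.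
HB.instance Definition _ :=
  GRing.isLinear.Build R (f24 R) P *:%R graph graph_linear.

Definition grading (k : int) : {vspace P} :=
  if k < 0 then (linfun embed @: f24_stratum R k)%VS
  else if k == 0 then <[((0, 1)%R : P)]>%VS else 0%VS.

Lemma embed_gradingP (k : int) (u : P) : k < 0 ->
  u \in grading k <-> u.2 = 0 /\ u.1 \in f24_stratum R k.
Proof.
rewrite /grading => ->; split=> [/memv_imgP[x xS ->]|[]].
  by rewrite lfunE.
case: u => x a /= -> xS; apply/memv_imgP; exists x => //.
by rewrite lfunE.
Qed.

Lemma grading0P (u : P) : u \in grading 0 <-> u.1 = 0.
Proof.
rewrite /grading /=; split=> [/vlineP[a ->]|]; first by rewrite /= scaler0.
case: u => x a /= ->; apply/vlineP; exists a.
by congr pair; rewrite ?scaler0// /GRing.scale /= mulr1.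
Qed.

(** A criterion uniform in the degree: all coordinates belonging to other degrees vanish. It turns
    membership into scalar equations. *)
Lemma gradingE (k : int) (u : P) : u \in grading k <->
  [/\ (k != -1 -> u.1$1 = 0 /\ u.1$2 = 0), (k != -2 -> u.1$3 = 0),
      (k != -3 -> u.1$4 = 0 /\ u.1$5 = 0),
      (k != -4 -> [/\ u.1$6 = 0, u.1$7 = 0 & u.1$8 = 0]) &
      (k != 0 -> u.2 = 0)].
Proof.
have [->|n1] := eqVneq k (-1).
  split=> [/embed_gradingP[]// -> /stratum1P ->|[_ h3 h4 h6 h0]].
    by rewrite !coord_row8.
  apply/embed_gradingP => //; split; first exact: h0.
  apply/stratum1P; rewrite {1}(row8_eta u.1) h3//.
  by have [-> ->] := h4 isT; have [-> -> ->] := h6 isT.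
have [->|n2] := eqVneq k (-2).
  split=> [/embed_gradingP[]// -> /stratum2P ->|[h1 _ h4 h6 h0]].
    by rewrite !coord_row8.
  apply/embed_gradingP => //; split; first exact: h0.
  apply/stratum2P; rewrite {1}(row8_eta u.1).
  by have [-> ->] := h1 isT; have [-> ->] := h4 isT; have [-> -> ->] := h6 isT.
have [->|n3] := eqVneq k (-3).
  split=> [/embed_gradingP[]// -> /stratum3P ->|[h1 h3 _ h6 h0]].
    by rewrite !coord_row8.
  apply/embed_gradingP => //; split; first exact: h0.
  apply/stratum3P; rewrite {1}(row8_eta u.1) h3//.
  by have [-> ->] := h1 isT; have [-> -> ->] := h6 isT.
have [->|n4] := eqVneq k (-4).
  split=> [/embed_gradingP[]// -> /stratum4P ->|[h1 h3 h4 _ h0]].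
    by rewrite !coord_row8.
  apply/embed_gradingP => //; split; first exact: h0.
  apply/stratum4P; rewrite {1}(row8_eta u.1) h3//.
  by have [-> ->] := h1 isT; have [-> ->] := h4 isT.
(* The premises [true] are what the conditions [k != -1] to [k != -4] reduce to for the degrees
   still left. *)
have u1E : [/\ true -> u.1$1 = 0 /\ u.1$2 = 0, true -> u.1$3 = 0,
    true -> u.1$4 = 0 /\ u.1$5 = 0 &
    true -> [/\ u.1$6 = 0, u.1$7 = 0 & u.1$8 = 0]] <-> u.1 = 0.
  split=> [[h1 h3 h4 h6]|->]; last by rewrite !coord0.
  rewrite (row8_eta u.1) row8_0 h3//.
  by have [-> ->] := h1 isT; have [-> ->] := h4 isT; have [-> -> ->] := h6 isT.
have [->|n0] := eqVneq k 0.
  split=> [/grading0P/u1E[g1 g3 g4 g6]|[h1 h3 h4 h6 _]]; first by split.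
  by apply/grading0P; apply/u1E; split.
rewrite /grading (negbTE n0) /f24_stratum.
rewrite (negbTE n1) (negbTE n2) (negbTE n3) (negbTE n4).
rewrite limg0 if_same memv0; split=> [/eqP ->|[h1 h3 h4 h6 h0]].
  by rewrite /= !coord0.
have /u1E e1 : [/\ true -> u.1$1 = 0 /\ u.1$2 = 0, true -> u.1$3 = 0,
    true -> u.1$4 = 0 /\ u.1$5 = 0 &
    true -> [/\ u.1$6 = 0, u.1$7 = 0 & u.1$8 = 0]] by split.
by apply/eqP; rewrite (surjective_pairing u) e1 h0.
Qed.

Lemma gradingP (k : int) (u : P) : u \in grading k ->
  u = 0 \/ [\/ k = 0 /\ u = (0, u.2),
      k = -1 /\ u = (row8 u.1$1 u.1$2 0 0 0 0 0 0, 0),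
      k = -2 /\ u = (row8 0 0 u.1$3 0 0 0 0 0, 0) |
      k = -3 /\ u = (row8 0 0 0 u.1$4 u.1$5 0 0 0, 0) \/
      k = -4 /\ u = (row8 0 0 0 0 0 u.1$6 u.1$7 u.1$8, 0)].
Proof.
case: u => x a /gradingE[/= h1 h3 h4 h6 h0].
have [k1|/h1[e1 e2]] := eqVneq k (-1).
  right; apply: Or42; split=> //; rewrite k1 in h3 h4 h6 h0.
  rewrite {1}(row8_eta x) h0// h3//.
  by have [-> ->] := h4 isT; have [-> -> ->] := h6 isT.
have [k2|/h3 e3] := eqVneq k (-2).
  right; apply: Or43; split=> //; rewrite k2 in h4 h6 h0.
  rewrite {1}(row8_eta x) h0// e1 e2.
  by have [-> ->] := h4 isT; have [-> -> ->] := h6 isT.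
have [k3|/h4[e4 e5]] := eqVneq k (-3).
  right; apply: Or44; left; split=> //; rewrite k3 in h6 h0.
  rewrite {1}(row8_eta x) h0// e1 e2 e3.
  by have [-> -> ->] := h6 isT.
have [k4|/h6[e6 e7 e8]] := eqVneq k (-4).
  right; apply: Or44; right; split=> //; rewrite k4 in h0.
  by rewrite {1}(row8_eta x) h0// e1 e2 e3 e4 e5.
have x0 : x = 0 by rewrite (row8_eta x) row8_0 e1 e2 e3 e4 e5 e6 e7 e8.
have [k0|/h0 a0] := eqVneq k 0; first by right; apply: Or41; rewrite x0.
by left; rewrite x0 a0.
Qed.

Lemma pbracket0l u : pbracket 0 u = 0.
Proof.
case: pbracket_lie => /(_ (-1) 0 0 u) + _ _ _.
by rewrite scaleN1r oppr0 addr0 scaleN1r addNr.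
Qed.

Lemma pbracket0r u : pbracket u 0 = 0.
Proof.
case: pbracket_lie => _ /(_ (-1) 0 0 u) + _ _.
by rewrite scaleN1r oppr0 addr0 scaleN1r addNr.
Qed.

Lemma pbracket_grading (j k : int) (u v : P) :
  u \in grading j -> v \in grading k -> pbracket u v \in grading (j + k).
Proof.
move=> /gradingP[->|cu]; first by rewrite pbracket0l mem0v.
move=> /gradingP[->|cv]; first by rewrite pbracket0r mem0v.
(* Twenty-five pairs of degrees remain, each settled by coordinates. *)
case: cu => [[-> ->]|[-> ->]|[-> ->]|[[-> ->]|[-> ->]]];
case: cv => [[-> ->]|[-> ->]|[-> ->]|[[-> ->]|[-> ->]]].
all: apply/gradingE; rewrite /pbracket /= ?row8_0.
all: rewrite ?(derivation_row8, row8E) !coord_row8.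
all: split=> [] //= _; try split; ring.
Qed.

Lemma lker_embed : lker (linfun embed) = 0%VS.
Proof.
apply/eqP/lker0P => x y; rewrite !lfunE => -[]//.
Qed.

Lemma pairD (x y : f24 R) (a' b' : R^o) :
  ((x, a') : P) + (y, b') = (x + y, a' + b').
Proof. by []. Qed.

(** The images of e1 and e2 have degree k - 1 >= 0, so they are multiples (0, a) and (0, b) of the
    derivation. The derivation rule, carried along e3, e4, e6 to [e6, e1] = 0, gives b e6 - 3 a e7 =
    0; then [D] kills e1 and e2 and all they generate. *)
Lemma no_positive_part (k : int) (D : 'Hom(f24 R, P)) : 0 < k ->
  (forall (j : int) x, x \in f24_stratum R j -> D x \in grading (j + k)) ->
  (forall x y, D (f24_bracket x y) =
    pbracket (D x) (embed y) + pbracket (embed x) (D y)) ->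
  forall x, D x = 0.
Proof.
move=> k0 Dgr DB.
have Dv x : x \in f24_stratum R (-1) -> exists a, D x = (0, a).
  move=> /Dgr /gradingP; move: k0; case: k {Dgr} => [[|k]|]// _ [->|].
    by exists 0.
  by case=> [[_ ->]|[]|[]|[[]|[]]] //; exists (D x).2.
have [a D1] : exists a, D (row8 1 0 0 0 0 0 0 0) = (0, a).
  by apply/Dv/stratum1P; rewrite !coord_row8.
have [b D2] : exists a, D (row8 0 1 0 0 0 0 0 0) = (0, a).
  by apply/Dv/stratum1P; rewrite !coord_row8.
have pE x y a' b' : pbracket (x, a') (y, b') =
  (f24_bracket x y + a' *: derivation y - b' *: derivation x, 0) by [].
have step x y (u v : P) w : f24_bracket x y = w -> D x = u -> D y = v ->
    D w = pbracket u (embed y) + pbracket (embed x) v.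
  by move=> <- <- <-.
have calc := (derivation_row8, row8E).
have D3 : D (row8 0 0 1 0 0 0 0 0) = (row8 0 b 0 0 0 0 0 0, 0).
  rewrite (@step _ _ _ _ _ _ D2 D1); last by rewrite row8E; congr row8; ring.
  rewrite /embed ?row8_0 !pE pairD !calc.
  by congr pair; [congr row8; ring|rewrite addr0].
have D4 : D (row8 0 0 0 1 0 0 0 0) = (row8 0 0 b 0 0 0 0 0, 0).
  rewrite (@step _ _ _ _ _ _ D3 D1); last by rewrite row8E; congr row8; ring.
  rewrite /embed ?row8_0 !pE pairD !calc.
  by congr pair; [congr row8; ring|rewrite addr0].
have D5 : D (row8 0 0 0 0 1 0 0 0) = (row8 0 0 0 0 0 0 0 0, 0).
  rewrite (@step _ _ _ _ _ _ D3 D2); last by rewrite row8E; congr row8; ring.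
  rewrite /embed ?row8_0 !pE pairD !calc.
  by congr pair; [congr row8; ring|rewrite addr0].
have D6 : D (row8 0 0 0 0 0 1 0 0) = (row8 0 0 0 b (- a) 0 0 0, 0).
  rewrite (@step _ _ _ _ _ _ D4 D1); last by rewrite row8E; congr row8; ring.
  rewrite /embed ?row8_0 !pE pairD !calc.
  by congr pair; [congr row8; ring|rewrite addr0].
(* The left-hand side is [D] at [e6, e1] = 0, so the right-hand side is a constraint on a and b. *)
have : D (row8 0 0 0 0 0 0 0 0) = (row8 0 0 0 0 0 b (- 3 * a) 0, 0).
  rewrite (@step _ _ _ _ _ _ D6 D1); last by rewrite row8E; congr row8; ring.
  rewrite /embed ?row8_0 !pE pairD !calc.
  by congr pair; [congr row8; ring|rewrite addr0].
rewrite -row8_0 linear0 => /(congr1 fst) /= E.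
have b0 : b = 0 by move: (congr1 (fun x => x$6) E); rewrite coord0 coord_row8.
have a0 : a = 0.
  move: (congr1 (fun x => x$7) E); rewrite coord0 coord_row8; lra.
rewrite a0 b0 oppr0 -row8_0 in D1 D2 D3 D4 D5 D6.
have D7 : D (row8 0 0 0 0 0 0 1 0) = (0, 0).
  rewrite (@step _ _ _ _ _ _ D5 D1); last by rewrite row8E; congr row8; ring.
  by rewrite pbracket0l pbracket0r addr0.
have D8 : D (row8 0 0 0 0 0 0 0 1) = (0, 0).
  rewrite (@step _ _ _ _ _ _ D5 D2); last by rewrite row8E; congr row8; ring.
  by rewrite pbracket0l pbracket0r addr0.
move=> x.
have -> : x = x$1 *: row8 1 0 0 0 0 0 0 0 + x$2 *: row8 0 1 0 0 0 0 0 0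
  + x$3 *: row8 0 0 1 0 0 0 0 0 + x$4 *: row8 0 0 0 1 0 0 0 0
  + x$5 *: row8 0 0 0 0 1 0 0 0 + x$6 *: row8 0 0 0 0 0 1 0 0
  + x$7 *: row8 0 0 0 0 0 0 1 0 + x$8 *: row8 0 0 0 0 0 0 0 1.
  by rewrite {1}(row8_eta x) !row8E; congr row8; ring.
rewrite !linearD !linearZ /= D1 D2 D3 D4 D5 D6 D7 D8.
by rewrite !scaler0 !addr0.
Qed.

End Prolongation.

Section Modification.
Variable R : realType.
Implicit Types (v w x y : f24 R) (a b : R).
Local Notation P := (f24 R * R^o)%type.

Lemma sum_ord5 (F : nat -> P) :
  \sum_(k < 5) F k = F 0%N + (F 1%N + (F 2%N + (F 3%N + F 4%N))).
Proof.
by rewrite -(big_mkord xpredT F) /index_iota /= !big_cons big_nil addr0.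
Qed.

(** The five components occupy disjoint sets of coordinates, so a vanishing sum has vanishing
    terms. *)
Lemma grading_direct : directv (\sum_(k < 0 + 5) grading R (k%:Z - 4%:Z))%VS.
Proof.
apply/directv_sum_independent => us usG.
(* Index k stands for degree k - 4; natural indices allow the five components to be named. *)
pose U k : P := us (inord k).
have -> : \sum_(i < 0 + 5) us i = \sum_(i < 5) U i.
  by apply: eq_bigr => i _; rewrite /U inord_val.
have UG k : (k < 5)%N -> U k \in grading R (k%:Z - 4%:Z).
  by move=> k5; have := usG (inord k) isT; rewrite inordK.
have [//|z0 /stratum4P E0] := (embed_gradingP _ _).1 (UG 0%N isT).
have [//|z1 /stratum3P E1] := (embed_gradingP _ _).1 (UG 1%N isT).
have [//|z2 /stratum2P E2] := (embed_gradingP _ _).1 (UG 2%N isT).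
have [//|z3 /stratum1P E3] := (embed_gradingP _ _).1 (UG 3%N isT).
have /grading0P E4 := UG 4%N isT.
rewrite sum_ord5 => S.
have S2 : (U 4%N).2 = 0.
  by have := congr1 snd S; rewrite /= z0 z1 z2 z3 !add0r.
have S1 := congr1 fst S; rewrite /= E0 E1 E2 E3 E4 row8_0 !row8E in S1.
have c n := congr1 (fun x : f24 R => x$n) S1.
have := (c 1, c 2, c 3, c 4, c 5, c 6, c 7, c 8).
rewrite !coord_row8 !add0r !addr0 => -[[[[[[[c1 c2] c3] c4] c5] c6] c7] c8].
have U0 k : (k < 5)%N -> U k = 0.
  case: k => [|[|[|[|[|]]]]]// _; rewrite [LHS]surjective_pairing.
  - by rewrite z0 E0 c6 c7 c8 -row8_0.
  - by rewrite z1 E1 c4 c5 -row8_0.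
  - by rewrite z2 E2 c3 -row8_0.
  - by rewrite z3 E3 c1 c2 -row8_0.
  - by rewrite S2 E4.
by move=> i _; have := U0 i (ltn_ord i); rewrite /U inord_val.
Qed.

Lemma grading_full : (\sum_(k < 0 + 5) grading R (k%:Z - 4%:Z))%VS = fullv.
Proof.
apply/vspaceP => u; rewrite memvf.
pose F (k : nat) : P := match k with
  | 0 => (row8 0 0 0 0 0 u.1$6 u.1$7 u.1$8, 0)
  | 1 => (row8 0 0 0 u.1$4 u.1$5 0 0 0, 0)
  | 2 => (row8 0 0 u.1$3 0 0 0 0 0, 0)
  | 3 => (row8 u.1$1 u.1$2 0 0 0 0 0 0, 0)
  | _ => (0, u.2) end.
have -> : u = \sum_(k < 0 + 5) F k.
  rewrite (sum_ord5 F) /F !pairD [LHS]surjective_pairing.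
  congr pair; last by rewrite !add0r.
  by rewrite {1}(row8_eta u.1) row8_0 !row8E; congr row8; ring.
apply: memv_sumr => -[k k5] _; apply/gradingE => /=.
case: k k5 => [|[|[|[|[|]]]]]// _; rewrite /= ?coord_row8 ?coord0.
all: by split.
Qed.

Lemma g0_tanaka_prolongation :
  tanaka_prolongation (g0 R) (@pbracket R) (@grading R) 0 (linfun (@embed R)).
Proof.
split.
- exact: pbracket_lie.
- split; [exact: pbracket_grading| |exact: grading_direct|exact: grading_full].
  by move=> k k0; rewrite /grading ltNge (ltW k0) /= gt_eqF.
- split; first exact: lker_embed.
    move=> x y; rewrite !lfunE /pbracket /embed /= !scale0r.
    by congr pair; rewrite subr0 addr0.
  by move=> k k0; rewrite /grading k0.
- move=> D; split=> [/g0P[a Da]|[[z a] /grading0P /= -> uD]].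
    exists (0, a); first exact/grading0P.
    move=> x; rewrite !lfunE Da /pbracket /embed /= scale0r subr0.
    rewrite row8_0 (row8_eta x) !(derivation_row8, row8E).
    by congr pair; congr row8; ring.
  apply/g0P; exists a => y; have /(congr1 fst) := uD y.
  rewrite !lfunE /= => <-; rewrite scale0r subr0.
  by rewrite row8_0 (row8_eta y) !(derivation_row8, row8E); congr row8; ring.
- split.
    move=> k u k0 /gradingP; case: k k0 => [[|k]|]// _ [//|].
      case=> [[_ ->]|[]|[]|[[]|[]]]// h.
      (* Transitivity in degree 0: a D sends e1 to a e2, so a = 0. *)
      have := h (row8 1 0 0 0 0 0 0 0); rewrite lfunE.
      case/(_ _)/Wrap; first by apply/stratum1P; rewrite !coord_row8.
      rewrite /pbracket /embed /= => /(congr1 fst) /=.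
      rewrite row8_0 !(derivation_row8, row8E) => /(congr1 (fun x => x$2)).
      rewrite !coord_row8 !(mulr0, mul0r, mulr1, add0r, addr0, subrr, subr0).
      by move=> ->; rewrite -row8_0; reflexivity.
    by case=> [[]|[]|[]|[[]|[]]].
  (* In positive degree every admissible map is zero, hence represented by 0. *)
  move=> k D k0 Dgr DB; exists 0; first exact: mem0v.
  move=> x; rewrite pbracket0l; apply/esym.
  by apply: (no_positive_part k0) => // y z; rewrite DB !lfunE.
Qed.

(** * The modification as a graph over f24 *)

Definition modification : {vspace P} := limg (linfun (@graph R)).

Lemma modificationP (u : P) : u \in modification <-> u = graph u.1.
Proof.
split=> [/memv_imgP[x _ ->]|->]; first by rewrite lfunE.
by apply/memv_imgP; exists u.1; rewrite ?memvf// lfunE.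
Qed.

(** Neither the bracket nor the derivation produces an e1 component, which matches the zero second
    component of [pbracket]. So the graph is a subalgebra, isomorphic to the Lie algebra of
    [twisted_F24 1]. *)
Lemma graph_bracket v w : graph (gbracket 1 v w) = pbracket (graph v) (graph w).
Proof.
rewrite /graph /pbracket /gbracket /= scale1r addrA; congr pair.
rewrite /derivation !(coordD, coordN, coordZ, coord_row8) coord_bracket.
by ring.
Qed.

Lemma nonneg_part0 : nonneg_part (@grading R) 0 = grading R 0.
Proof. by rewrite /nonneg_part big_ord_recl big_ord0 addv0. Qed.

Lemma modification_sum0 : (modification + grading R 0)%VS = fullv.
Proof.
apply/vspaceP => u; rewrite memvf; apply/memv_addP.
exists (graph u.1); first exact/modificationP.
exists (0, u.2 - u.1$1); first exact/grading0P.
by rewrite [LHS]surjective_pairing /graph pairD addr0 addrC subrK.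
Qed.

Lemma modification_cap0 : (modification :&: grading R 0)%VS = 0%VS.
Proof.
apply/eqP; rewrite -subv0.
apply/subvP => u /memv_capP[/modificationP uE /grading0P u0].
by rewrite memv0 uE u0 /graph coord0.
Qed.

Lemma modification_twisted1 : modification_of_F24 (twisted_F24 (1 : R)).
Proof.
exists (g0 R), P, (@pbracket R), (@grading R), 0%N,
  (linfun (@embed R)), modification,
  ((grading R (-1) + grading R 0) :&: modification)%VS.
split.
- exact: g0_der_subalgebra.
- exact: g0_tanaka_prolongation.
- split; rewrite ?nonneg_part0//;
    [|exact: modification_sum0|exact: modification_cap0].
  move=> u v /modificationP -> /modificationP ->; apply/modificationP.
  by rewrite -graph_bracket.
exists (fun X => graph (field_at0 X)).
  have [_ brE [_ inj surj]] := field_at0_iso (1 : R).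
  split.
  + by move=> a X Y _ _; rewrite field_at0_linear linearP.
  + by move=> X Y LX LY; rewrite brE// graph_bracket.
  + split.
    * by move=> X _; exact/modificationP.
    * by move=> X Y LX LY [E _]; exact: inj.
    * move=> u /modificationP ->; have [X LX XE] := surj u.1 I.
      by exists X => //; rewrite XE.
rewrite -[X in X = _](image_comp (@field_at0 R) (@graph R)) field_at0_horizontal.
(* An element of the graph lies in degrees -1 and 0 exactly when its component in [f24] lies in the
   first stratum. *)
apply/seteqP; split=> [_ [v vS <-]|u /memv_capP[/memv_addP[u1]]].
  apply/memv_capP; split; last exact/modificationP.
  apply/memv_addP; exists (v, 0); first exact/embed_gradingP.
  exists (0, v$1); first exact/grading0P.
  by rewrite /graph pairD addr0 add0r.
move=> /embed_gradingP[]// _ u1S [u2 /grading0P u20 uE] /modificationP ug.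
exists u.1; last by [].
by rewrite /= uE /= u20 addr0.
Qed.

End Modification.

(* The first conjunct certifies that the group F24 is the one it stands for. *)
Theorem theorem5p5 (R : realType) :
  F24_characterisation (F24 R) /\
  exists S : polarised_group R,
    is_polarised_lie_group S /\
    nilpotent_group S /\
    ~ lie_group_isomorphic S (F24 R) /\
    modification_of_F24 S /\
    globally_contactomorphic S (F24 R).
Proof.
split; first exact: F24_characterised.
exists (twisted_F24 1); split; first exact: twisted_is_polarised_lie_group.
split; first exact: twisted_nilpotent.
split; first by rewrite F24_twisted0; exact: twisted1_not_isomorphic.
split; first exact: modification_twisted1.
by rewrite F24_twisted0; exact: twisted_contactomorphic.
Qed.
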